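(* Let $\Gamma$ be a connected metric graph of first Betti number $b\geq 2$ and of length equal to $b$. Let $n\in\{1,\ldots,b\}$. Then there exist at least $n$ homologically independent loops in $\Gamma$ based at the same point and each of length at most $24(\log(b)+n)$.
   Context: $\log$ denotes the natural logarithm. A graph is a finite one-dimensional CW-complex (multiple edges and loops are allowed). A metric graph is a graph endowed with a length space metric; the length of a (sub)graph is its one-dimensional Hausdorff measure. The first Betti number of a graph is $e-v+c$, where $e$, $v$, $c$ are the numbers of edges, vertices and connected components. A family of loops $(\alpha_1,\ldots,\alpha_k)$ in $\Gamma$ is homologically independent if their homology classes in $H_1(\Gamma,\mathbb{R})$ are linearly independent. *)

(* Defs.v *)
(* MathComp-Analysis; the real numbers are an arbitrary [R : realType]. *)
From HB Require Import structures.
From mathcomp Require Import all_boot all_order all_algebra finmap.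
From mathcomp Require Import all_classical all_reals all_analysis.

Set Implicit Arguments.
Unset Strict Implicit.
Unset Printing Implicit Defensive.

Import Order.TTheory GRing.Theory Num.Theory.
Import numFieldNormedType.Exports.

Local Open Scope classical_set_scope.
Local Open Scope ring_scope.

(* A curve is a function on all of [R] of which only the restriction to [0, 1]
   matters: everything below depends on that restriction only. *)

Definition is_curve (R : realType) (T : metricType R) (x y : T)
    (gamma : R -> T) : Prop :=
  [/\ {within `[0, 1], continuous gamma}, gamma 0 = x & gamma 1 = y].

Definition is_loop (R : realType) (T : metricType R) (x : T)
    (gamma : R -> T) : Prop := is_curve x x gamma.

(* Metric analogue of [variation] and [total_variation]: as in [itv_partition],
   [s] lists the points of a subdivision of [0, 1] other than 0. *)
Definition polygonal_length (R : realType) (T : metricType R)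
    (gamma : R -> T) (s : seq R) : R :=
  let F := gamma \o nth 1 (0 :: s) in
  \sum_(0 <= i < size s) mdist (F i) (F i.+1).

Definition curve_length (R : realType) (T : metricType R)
    (gamma : R -> T) : \bar R :=
  ereal_sup [set (polygonal_length gamma s)%:E | s in itv_partition 0 1].

(* Since [mdist] is finite, this is the notion for a path-connected space. *)
Definition length_space (R : realType) (T : metricType R) : Prop :=
  forall x y : T,
    (mdist x y)%:E =
      ereal_inf [set curve_length gamma | gamma in is_curve x y].

(* The point 0 is added so that the empty set has diameter 0, not -oo. *)
Definition diameter (R : realType) (T : metricType R) (A : set T) : \bar R :=
  ereal_sup ([set 0%E] `|` [set (mdist x y)%:E | x in A & y in A]).

Definition hausdorff1_delta (R : realType) (T : metricType R) (delta : R)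
    (A : set T) : \bar R :=
  ereal_inf [set (\sum_(0 <= i <oo) diameter (U i))%E |
    U in [set U : nat -> set T |
      (forall i, (diameter (U i) <= delta%:E)%E) /\ A `<=` \bigcup_i U i]].

Definition hausdorff1 (R : realType) (T : metricType R) (A : set T) : \bar R :=
  ereal_sup [set hausdorff1_delta delta A | delta in [set d : R | 0 < d]].

(* A finite one-dimensional CW structure on [T]. In a Hausdorff space with
   finitely many cells, the conditions below are all the CW axioms: a
   characteristic map that is injective on the open cell and sends the boundary
   to the vertices is by compactness a homeomorphism from the open cell onto
   its image, and closure finiteness and the weak topology are automatic.
   Loops and multiple edges are allowed, as are isolated vertices. *)
Record graph_structure (R : realType) (T : metricType R) := GraphStructure {
  gvertex : finType ;
  gedge : finType ;
  vertex_pt : gvertex -> T ;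
  edge_map : gedge -> R -> T ;
  vertex_pt_inj : injective vertex_pt ;
  edge_map_continuous : forall e, {within `[0, 1], continuous (edge_map e)} ;
  edge_map_start : forall e, range vertex_pt (edge_map e 0) ;
  edge_map_end : forall e, range vertex_pt (edge_map e 1) ;
  edge_map_inj : forall e e' (s t : R), 0 < s < 1 -> 0 < t < 1 ->
    edge_map e s = edge_map e' t -> e = e' /\ s = t ;
  edge_map_vertex : forall e (s : R), 0 < s < 1 ->
    ~ range vertex_pt (edge_map e s) ;
  graph_cover : forall x : T, range vertex_pt x \/
    exists e (s : R), 0 < s < 1 /\ x = edge_map e s
}.

Definition num_components (T : topologicalType) : nat :=
  #|` fset_set [set connected_component [set: T] x | x in [set: T]] |.

Definition betti1 (R : realType) (T : metricType R)
    (G : graph_structure T) : int :=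
  #|gedge G|%:Z - #|gvertex G|%:Z + (num_components T)%:Z.

(* Singular homology in degree one with real coefficients. The standard
   1-simplex is [0, 1] and the standard 2-simplex is the triangle with ordered
   vertices (0, 0), (1, 0), (0, 1). A chain is a list of weighted simplices;
   two lists represent the same element of the free module when their
   coefficients along every simplex agree. *)

Definition simplex2 (R : realType) : set (R * R) :=
  [set p | [/\ 0 <= p.1, 0 <= p.2 & p.1 + p.2 <= 1]].

Definition chain_coef (R : realType) (T : metricType R)
    (c : seq (R * (R -> T))) (tau : R -> T) : R :=
  \sum_(p <- c | `[< {in `[0, 1], p.2 =1 tau} >]) p.1.

Definition eq_chain1 (R : realType) (T : metricType R)
    (c d : seq (R * (R -> T))) : Prop := chain_coef c =1 chain_coef d.

Definition face2 (R : realType) (T : metricType R) (sigma : R * R -> T)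
    (i : nat) : R -> T :=
  fun t => sigma (nth (0, 0) [:: (1 - t, t); (0, t); (t, 0)] i).

Definition boundary2 (R : realType) (T : metricType R) (m : nat)
    (d : 'I_m -> R) (sigma : 'I_m -> R * R -> T) : seq (R * (R -> T)) :=
  [seq ((-1) ^+ i * d j, face2 (sigma j) i) | j <- enum 'I_m, i <- iota 0 3].

Definition null_homologous (R : realType) (T : metricType R)
    (c : seq (R * (R -> T))) : Prop :=
  exists (m : nat) (d : 'I_m -> R) (sigma : 'I_m -> R * R -> T),
    (forall j, {within @simplex2 R, continuous (sigma j)}) /\
    eq_chain1 c (boundary2 d sigma).

(* Linear independence of the classes of the loops [alpha i] in H_1(T, R),
   the quotient of the 1-cycles by the boundaries of 2-chains. *)
Definition homologically_independent (R : realType) (T : metricType R)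
    (k : nat) (alpha : 'I_k -> R -> T) : Prop :=
  forall a : 'I_k -> R,
    null_homologous [seq (a i, alpha i) | i <- enum 'I_k] ->
    forall i, a i = 0.

(* Main.v *)
Require Import Defs.
From mathcomp Require Import all_boot all_order all_algebra finmap.
From mathcomp Require Import all_classical all_reals all_analysis.
From mathcomp Require Import ring lra zify.

(** The theorem is a statement about a finite graph with edge lengths: the loops
    are concatenations of edges, and their independence in homology is read off
    the numbers of times that they run along each edge.

    Combinatorial part.  Let the edge lengths add up to at most [b] and let
    [#|E| - #|V| = b - 1].  A set [X] of vertices close to a vertex [x] with a
    set [S] of short edges between vertices of [X], [#|S| - #|X| >= n - 1], gives
    [n] independent loops at [x]: go to one end of an edge of [S], cross it, and
    come back.  Modulo the span of the paths that lead from [x] to the other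
    [#|X| - 1] vertices, these loops are just the edges of [S], whence the rank
    ([rich_region_loops]).

    Suppose that no such region exists.  Share the length of each edge between
    its two ends, so that every set of vertices has a volume.  In a ball whose
    radius grows, the number of edges that stick out is the rate at which the
    covered length grows.  The covered length first reaches [4 n], since a
    connected graph always has an edge sticking out of a ball that is not
    everything; afterwards it cannot double every 4 units for longer than
    [4 log_2 b] because the total length is [b].  So at some radius
    [O(n + log b)] the ball [B] has volume at least [2 n] and at most
    [vol B / 2] edges stick out ([sparse_radius]).  Remove such a ball, together
    with the connected pieces of small volume that it cuts off, and repeat.  The
    removed part [X] is not a rich region, so removing it with the edges cut
    lowers [#|E| - #|V|] by at most [n - 2 + vol B / 2 < vol X - 1].  Once
    everything is removed this yields [b - 1 < b - 1] ([bulky_bound],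
    [rich_region_exists]).

    Topological part.  Pairwise disjoint compact arcs lie at a positive distance
    from each other, so a cover by small enough sets treats them separately; on
    each arc the distance to one end is a 1-Lipschitz function that takes all
    values up to the distance of the ends.  Hence the lengths of the edges add
    up to at most the Hausdorff measure ([disjoint_arcs_length],
    [sum_edge_length]).  For homology, each edge [e] carries a map to the circle
    [R/Z], its parameter on the open edge and 0 elsewhere.  The winding number
    of a curve under this map kills the boundaries of singular 2-chains, because
    a circle-valued map lifts to [R] over a triangle ([simplex_lift],
    [null_homologous_winding]); on a concatenation of edges it counts the signed
    passages through [e] ([winding_walk]). *)

Set Implicit Arguments.
Unset Strict Implicit.
Unset Printing Implicit Defensive.

Import Order.TTheory GRing.Theory Num.Theory.
Import numFieldNormedType.Exports.
Local Open Scope ring_scope.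

(** * Coverings of the half-line by intervals *)

Section Growth.
Variables (R : realType) (I : finType) (a c : I -> R).

(** The total length of the parts of the intervals [a i, c i[ that lie below [r]. *)
Definition covered (r : R) : R := \sum_i Num.max 0 (Num.min (c i) r - a i).
Definition active (r : R) : {set I} := [set i | a i <= r < c i].

Lemma in_active i r : (i \in active r) = (a i <= r < c i).
Proof. by rewrite inE. Qed.

Lemma clip_homo i r s : r <= s ->
  Num.max 0 (Num.min (c i) r - a i) <= Num.max 0 (Num.min (c i) s - a i).
Proof.
move=> rs; rewrite ge_max le_max lexx /= le_max; apply/orP; right.
by rewrite lerD2r le_min ge_min lexx /= ge_min rs orbT.
Qed.

Lemma covered_homo r s : r <= s -> covered r <= covered s.
Proof.
by move=> rs; apply: ler_sum => i _; exact: clip_homo.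
Qed.

(** Between two consecutive right ends the count of active intervals does not
    drop, so the bound at the left end of such a gap is enough; the induction is
    on the number of right ends strictly between [r] and [s]. *)
Lemma covered_growth (k r s : R) : r <= s ->
  (forall t, r <= t < s -> k <= #|active t|%:R) ->
  covered r + k * (s - r) <= covered s.
Proof.
have [m] := ubnP #|[set i | r < c i < s]|.
elim: m r s => // m IH r s; rewrite ltnS => cardm rs k_le.
have [|none] := boolP [exists i, r < c i < s].
  case/existsP => i /andP[rc cs].
  have lt1 : (#|[set j | (r < c j < c i)%R]| < m)%N.
    apply: leq_trans cardm; apply/proper_card/properP; split.
      apply/fintype.subsetP => j; rewrite !inE => /andP[-> /lt_trans]; exact.
    by exists i; rewrite !inE ?rc ?cs // ltxx andbF.
  have lt2 : (#|[set j | (c i < c j < s)%R]| < m)%N.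
    apply: leq_trans cardm; apply/proper_card/properP; split.
      by apply/fintype.subsetP => j; rewrite !inE => /andP[/(lt_trans rc)-> ->].
    by exists i; rewrite !inE ?rc ?cs // ltxx.
  have h1 : covered r + k * (c i - r) <= covered (c i).
    apply: IH => // [|t /andP[rt tc]]; first exact: ltW.
    by apply: k_le; rewrite rt (lt_trans tc).
  have h2 : covered (c i) + k * (s - c i) <= covered s.
    apply: IH => // [|t /andP[ct ts]]; first exact: ltW.
    by apply: k_le; rewrite ts (le_trans (ltW rc)).
  by lra.
move: rs; rewrite le_eqVlt => /orP[/eqP->|rs]; first by rewrite subrr mulr0 addr0.
have kr : k <= #|active r|%:R by apply: k_le; rewrite lexx rs.
apply: (@le_trans _ _ (covered r + \sum_(i in active r) (s - r))).
  rewrite lerD2l sumr_const -mulr_natl ler_wpM2r // subr_ge0; exact: ltW.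
rewrite big_mkcond -big_split /=; apply: ler_sum => i _; rewrite inE.
move/existsPn: none => /(_ i); rewrite negb_and -!leNgt => none.
case: ifP => [/andP[ar rc]|_].
  have sc : s <= c i by case/orP: none => //; lra.
  by rewrite (min_r (ltW rc)) (min_r sc) !max_r; lra.
by rewrite addr0 clip_homo // ltW.
Qed.

End Growth.

(** * Walks in a finite graph with edge lengths *)

Section Graph.
Variables (R : realType) (V E : finType) (src tgt : E -> V) (len : E -> R).
Hypothesis len_ge0 : forall e, 0 <= len e.

Implicit Types (U X Y : {set V}) (e : E) (p q : seq (E * bool)).

(** A dart is an edge with a direction; [true] is the direction from [src] to
    [tgt]. *)
Definition dart_src (d : E * bool) : V := if d.2 then src d.1 else tgt d.1.
Definition dart_tgt (d : E * bool) : V := if d.2 then tgt d.1 else src d.1.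

Fixpoint walk (U : {set V}) (x : V) (p : seq (E * bool)) (y : V) : bool :=
  if p is d :: q then [&& x \in U, dart_src d == x & walk U (dart_tgt d) q y]
  else (x == y) && (x \in U).

Definition wlen (p : seq (E * bool)) : R := \sum_(d <- p) len d.1.

Definition wcount (p : seq (E * bool)) (e : E) : R :=
  \sum_(d <- p) (if d.1 == e then if d.2 then 1 else -1 else 0).

Definition rev_walk (p : seq (E * bool)) : seq (E * bool) :=
  rev [seq (d.1, ~~ d.2) | d <- p].

Lemma wlen_ge0 p : 0 <= wlen p.
Proof. exact: sumr_ge0. Qed.

Lemma wlen_cat p q : wlen (p ++ q) = wlen p + wlen q.
Proof. exact: big_cat. Qed.

Lemma wlen_rev p : wlen (rev_walk p) = wlen p.
Proof. by rewrite /wlen /rev_walk -map_rev big_map (perm_big _ (permEl (perm_rev p))). Qed.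

Lemma wcount_cat p q e : wcount (p ++ q) e = wcount p e + wcount q e.
Proof. exact: big_cat. Qed.

Lemma wcount_rev p e : wcount (rev_walk p) e = - wcount p e.
Proof.
rewrite /wcount /rev_walk -map_rev big_map (perm_big _ (permEl (perm_rev p))) -sumrN.
by apply: eq_bigr => -[f []] _ /=; case: ifP; rewrite ?opprK ?oppr0.
Qed.

Lemma walk_cat U x p y q z : walk U x p y -> walk U y q z -> walk U x (p ++ q) z.
Proof.
elim: p x => [x /andP[/eqP-> _] //|d p IH x /= /and3P[-> -> /IH h] /h ->//].
Qed.

Lemma walk_meml U x p y : walk U x p y -> x \in U.
Proof. by case: p => [/andP[]|d p /and3P[]]. Qed.

Lemma walk_rev U x p y : walk U x p y -> walk U y (rev_walk p) x.
Proof.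
elim: p x => [x /andP[/eqP-> yU] /=|d p IH x /= /and3P[xU /eqP dx w]].
  by rewrite eqxx.
rewrite /rev_walk /= rev_cons -cats1; apply: (walk_cat (IH _ w)) => /=.
rewrite (walk_meml w); move: xU; rewrite -dx /dart_src /dart_tgt /=.
by case: (d.2) => /= ->; rewrite !eqxx.
Qed.

Lemma walk_sub (U U' : {set V}) x p y : U \subset U' -> walk U x p y -> walk U' x p y.
Proof.
move=> /fintype.subsetP UU'; elim: p x => [x /= /andP[-> /UU']//|d p IH x /=].
by case/and3P=> xU dx w; rewrite (UU' _ xU) dx; exact: IH.
Qed.

Lemma walk1 (U : {set V}) d : dart_src d \in U -> dart_tgt d \in U ->
  walk U (dart_src d) [:: d] (dart_tgt d).
Proof. by move=> h1 h2; rewrite /= h1 h2 !eqxx. Qed.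

(** Each edge gives half of its length to each of its ends, so that the volume is
    additive over disjoint sets of vertices and the whole graph has volume the
    total length. *)
Definition mass (v : V) : R :=
  \sum_e (len e / 2) * ((src e == v)%:R + (tgt e == v)%:R).
Definition vol (X : {set V}) : R := \sum_(v in X) mass v.

Lemma mass_ge0 v : 0 <= mass v.
Proof. by apply: sumr_ge0 => e _; rewrite mulr_ge0 ?divr_ge0 // addr_ge0. Qed.

Lemma vol_ge0 X : 0 <= vol X.
Proof. by apply: sumr_ge0 => v _; exact: mass_ge0. Qed.

Lemma vol_sub (X Y : {set V}) : X \subset Y -> vol X <= vol Y.
Proof.
move=> XY; rewrite /vol [leRHS](big_setID X) /= (finset.setIidPr XY) lerDl.
exact: vol_ge0.
Qed.

Lemma volD (X Y : {set V}) : X \subset Y -> vol Y = vol X + vol (Y :\: X).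
Proof. by move=> XY; rewrite /vol [LHS](big_setID X) /= (finset.setIidPr XY). Qed.

Lemma len_mass e v : (src e == v) || (tgt e == v) -> len e <= 2 * mass v.
Proof.
move=> ev; rewrite /mass (bigD1 e) //=.
have h : 0 <= \sum_(i | i != e) len i / 2 * ((src i == v)%:R + (tgt i == v)%:R).
  by apply: sumr_ge0 => i _; rewrite mulr_ge0 ?divr_ge0 // addr_ge0.
have := len_ge0 e.
by case: (src e == v) ev h; case: (tgt e == v) => //= _; rewrite !mulrDr; set s := (\sum_(i | _) _) => ??; lra.
Qed.

Lemma vol_len X : vol X = \sum_e (len e / 2) * ((src e \in X)%:R + (tgt e \in X)%:R).
Proof.
rewrite /vol /mass exchange_big /=; apply: eq_bigr => e _.
have h v : \sum_(w in X) (v == w)%:R = (v \in X)%:R :> R.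
  case: (boolP (v \in X)) => vX; last first.
    by rewrite big1 // => w wX; case: eqP => // vw; rewrite vw wX in vX.
  rewrite (bigD1 v) //= eqxx big1 ?addr0 // => w /andP[_].
  by rewrite eq_sym => /negPf->.
by rewrite -mulr_sumr big_split /= !h.
Qed.

Lemma vol_setT : vol [set: V] = \sum_e len e.
Proof.
rewrite vol_len; apply: eq_bigr => e _; rewrite !inE /=.
by rewrite -[1 + 1]/(2%:R) divfK // pnatr_eq0.
Qed.

(** * Components of induced subgraphs *)

Definition adj (U : {set V}) : rel V := fun u v =>
  [&& u \in U, v \in U & [exists d : E * bool, (dart_src d == u) && (dart_tgt d == v)]].

Definition component (U : {set V}) (v : V) : {set V} := [set w in U | connect (adj U) v w].

Lemma adj_dart (U : {set V}) d : dart_src d \in U -> dart_tgt d \in U ->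
  adj U (dart_src d) (dart_tgt d).
Proof. by move=> h1 h2; rewrite /adj h1 h2; apply/existsP; exists d; rewrite !eqxx. Qed.

Lemma adj_sym U : symmetric (adj U).
Proof.
move=> u v; rewrite /adj andbCA; do 2 congr (_ && _).
by apply/existsP/existsP => -[[e b] /andP[/eqP du /eqP dv]]; exists (e, ~~ b);
  move: du dv; rewrite /dart_src /dart_tgt /=; case: b => /= -> ->; rewrite !eqxx.
Qed.

Lemma connect_adj_sym U : connect_sym (adj U).
Proof. exact/sym_connect_sym/adj_sym. Qed.

Lemma adj_sub (U U' : {set V}) : U \subset U' -> subrel (adj U) (adj U').
Proof.
by move=> /fintype.subsetP UU' u v /and3P[/UU' uU /UU' vU h]; rewrite /adj uU vU.
Qed.

Lemma component_sub (U U' : {set V}) v : U \subset U' -> component U v \subset component U' v.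
Proof.
move=> UU'; apply/fintype.subsetP => w; rewrite !inE => /andP[wU vw].
rewrite (fintype.subsetP UU') //=; apply: (connect_sub _ vw) => a b ab.
exact/connect1/(adj_sub UU').
Qed.

Lemma component_subset (U : {set V}) v : component U v \subset U.
Proof. by apply/fintype.subsetP => w; rewrite inE => /andP[]. Qed.

Lemma mem_component (U : {set V}) v : v \in U -> v \in component U v.
Proof. by rewrite inE => ->; rewrite connect0. Qed.

Lemma component_adj U v a b : a \in component U v -> adj U a b -> b \in component U v.
Proof.
rewrite !inE => /andP[_ va] ab; case/and3P: (ab) => _ -> _ /=.
exact: connect_trans va (connect1 ab).
Qed.

Lemma component_eq U a b : adj U a b -> component U a = component U b.
Proof.
move=> ab; apply/setP => w; rewrite !inE; congr (_ && _).
exact: (same_connect (connect_adj_sym U)) (connect1 ab) w.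
Qed.

Lemma component_mem U v w : w \in component U v -> component U w = component U v.
Proof.
rewrite inE => /andP[_ vw]; apply/setP => z; rewrite !inE; congr (_ && _).
by apply/esym; exact: (same_connect (connect_adj_sym U)) vw z.
Qed.

Lemma connect_exit (e : rel V) (A : {set V}) v z :
  connect e v z -> v \in A -> z \notin A -> exists a a', [/\ a \in A, a' \notin A & e a a'].
Proof.
case/connectP=> p; elim: p v => [v _ /= <- -> //|w p IH v /= /andP[vw ep] zE vA zA].
have [wA|wA] := boolP (w \in A); first exact: IH ep zE wA zA.
by exists v, w.
Qed.

(** An edge has at most twice the mass of any of its ends, which pays for the
    edge by which the path leaves each vertex. *)
Lemma path_walk U v s : v \in U -> path (adj U) v s ->
  exists2 p, walk U v p (last v s) & wlen p <= \sum_(z <- belast v s) 2 * mass z.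
Proof.
elim: s v => [v vU _|w s IH v vU /= /andP[/and3P[_ wU /existsP[d /andP[/eqP dv /eqP dw]]] ws]].
  by exists [::]; rewrite /= ?eqxx // /wlen !big_nil.
have [p wp lp] := IH _ wU ws; exists (d :: p); first by rewrite /= vU dv eqxx dw.
rewrite /wlen !big_cons lerD //; apply: len_mass => //.
by move: dv; rewrite /dart_src; case: d.2 => ->; rewrite eqxx ?orbT.
Qed.

(** A path without repetition pays for each of its vertices once; the mass of the
    last vertex is left over, and can pay for one more edge. *)
Lemma short_walk U v w : v \in U -> w \in component U v ->
  exists2 p, walk U v p w & wlen p + 2 * mass w <= 2 * vol (component U v).
Proof.
move=> vU; rewrite inE => /andP[wU /connectP[s vs ->{w wU}]].
case/shortenP: vs => s' vs' us' _.
have [p wp lp] := path_walk vU vs'; exists p => //.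
apply: le_trans (lerD lp (lexx _)) _.
rewrite addrC -(big_cons _ _ _ _ xpredT (fun z => 2 * mass z)) -mulr_sumr.
rewrite ler_pM2l // (perm_big (v :: s')) /=; last first.
  by rewrite (lastI v s') -cats1 perm_sym perm_catC.
rewrite big_uniq //= /vol /=.
apply: le_trans (vol_sub (_ : [set z in v :: s'] \subset _)); last first.
  apply/fintype.subsetP => z; rewrite inE => zs; rewrite inE (path_connect vs' zs) andbT.
  have: all (mem U) (v :: s').
    rewrite /= vU; elim: s' v {vU us' p wp lp zs} vs' => //= y s' IH v.
    by case/andP=> /and3P[_ -> _]; exact: IH.
  by move/allP; apply.
by rewrite /vol le_eqVlt; apply/orP; left; apply/eqP/eq_bigl => z; rewrite inE.
Qed.
(** * Growing a ball until few edges stick out *)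

(** The infimum replaces a shortest walk: every vertex of the component is
    reached by a walk longer than [wdist] by as little as wanted, and this loss is
    absorbed by the constants. *)
Definition wdist U x v : R := inf [set wlen p | p in [set p | walk U x p v]]%classic.

Lemma wdist_lb U x v p : walk U x p v -> wdist U x v <= wlen p.
Proof.
move=> w; apply: ge_inf; last by exists p.
by exists 0 => _ [q _ <-]; exact: wlen_ge0.
Qed.

Lemma wdist_adherent U x v eps : 0 < eps -> v \in component U x -> x \in U ->
  exists2 p, walk U x p v & wlen p < wdist U x v + eps.
Proof.
move=> eps0 vx xU; have [p wp _] := short_walk xU vx.
have [|_ [q wq <-] lq] := @inf_adherent R [set wlen p | p in [set p | walk U x p v]]%classic _ eps0.
  split; first by exists (wlen p), p.
  by exists 0 => _ [q _ <-]; exact: wlen_ge0.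
by exists q.
Qed.

Lemma wdist_ge0 U x v : x \in U -> v \in component U x -> 0 <= wdist U x v.
Proof.
move=> xU vx; have [p wp _] := short_walk xU vx.
apply: lb_le_inf; first by exists (wlen p), p.
by move=> _ [q _ <-]; exact: wlen_ge0.
Qed.

Lemma wdist_refl U x : x \in U -> wdist U x x = 0.
Proof.
move=> xU; apply/eqP; rewrite eq_le wdist_ge0 ?mem_component // andbT.
have := @wdist_lb U x x [::]; rewrite /= eqxx xU /wlen big_nil; exact.
Qed.

Lemma wdist_dart U x d : x \in U -> dart_src d \in component U x -> dart_tgt d \in U ->
  wdist U x (dart_tgt d) <= wdist U x (dart_src d) + len d.1.
Proof.
move=> xU dx dU; apply/ler_addgt0Pl => eps eps0.
have [p wp lp] := wdist_adherent eps0 dx xU.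
apply: le_trans (wdist_lb (walk_cat wp (walk1 _ dU))) _.
  exact: fintype.subsetP (component_subset U x) _ dx.
by rewrite wlen_cat {2}/wlen big_seq1; lra.
Qed.

Definition inner_edges X : {set E} := [set e | (src e \in X) && (tgt e \in X)].

Section Ball.
Variables (U : {set V}) (x : V).
Hypothesis xU : x \in U.
Let H := component U x.
Let d := wdist U x.

Lemma wdist_edge e : e \in inner_edges H -> d (tgt e) <= d (src e) + len e /\ d (src e) <= d (tgt e) + len e.
Proof.
rewrite inE => /andP[se te]; split.
  by apply: (@wdist_dart U x (e, true)) => //; exact: fintype.subsetP (component_subset U x) _ te.
by apply: (@wdist_dart U x (e, false)) => //; exact: fintype.subsetP (component_subset U x) _ se.
Qed.

Definition wball r : {set V} := [set v in H | d v <= r].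

Lemma in_wball r v : (v \in wball r) = (v \in H) && (d v <= r).
Proof. by rewrite inE. Qed.

Lemma in_inner_edges X e : (e \in inner_edges X) = (src e \in X) && (tgt e \in X).
Proof. by rewrite inE. Qed.

(** Think of an edge as a segment that the growing ball invades from both ends.
    It is partly covered from the radius at which its nearer end is reached until
    the two fronts meet, at half the sum of the distances of its ends and of its
    length. Edges outside [H] are given an empty interval. *)
Definition opens e : R := if e \in inner_edges H then Num.min (d (src e)) (d (tgt e)) else 0.
Definition closes e : R := if e \in inner_edges H then (d (src e) + d (tgt e) + len e) / 2 else 0.

Lemma closes_opens e : closes e - opens e <= len e.
Proof.
rewrite /closes /opens; case: ifP => [|_]; last by rewrite subrr.
by case/wdist_edge => h1 h2; case: (lerP (d (src e)) (d (tgt e))) => ?; lra.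
Qed.

Lemma covered_le_len r : covered opens closes r <= \sum_e len e.
Proof.
apply: ler_sum => e _; rewrite ge_max len_ge0 /=.
by apply: le_trans (closes_opens e); rewrite lerB // ge_min lexx.
Qed.

(** An edge that is partly covered has an end in the ball, and gives it half of its
    length. *)
Lemma covered_le_vol r : covered opens closes r <= 2 * vol (wball r).
Proof.
rewrite vol_len mulr_sumr; apply: ler_sum => e _.
have l0 := len_ge0 e.
rewrite ge_max; apply/andP; split.
  by rewrite !mulr_ge0 ?divr_ge0 ?addr_ge0.
have [eH|eH] := boolP (e \in inner_edges H); last first.
  rewrite /closes /opens (negPf eH) subr0 ge_min.
  by rewrite !mulr_ge0 ?divr_ge0 ?addr_ge0.
have [ro|ro] := leP (opens e) r; last first.
  apply: (@le_trans _ _ 0); last by rewrite !mulr_ge0 ?divr_ge0 ?addr_ge0.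
  by rewrite subr_le0 ge_min (ltW ro) orbT.
apply: (@le_trans _ _ (len e)).
  by apply: le_trans (closes_opens e); rewrite lerB // ge_min lexx.
have : 1 <= (src e \in wball r)%:R + (tgt e \in wball r)%:R :> R.
  rewrite -natrD ler1n addn_gt0 !lt0b !in_wball.
  move: eH ro; rewrite /opens => eH; rewrite eH ge_min.
  by move: eH; rewrite in_inner_edges => /andP[-> ->].
set s := _ + _ => s1; rewrite mulrA mulrC -[leLHS]mul1r ler_pM //; lra.
Qed.

Lemma wball_closed e r : e \in inner_edges H -> e \notin active opens closes r ->
  (src e \in wball r) || (tgt e \in wball r) ->
  d (src e) + d (tgt e) + len e <= 2 * r.
Proof.
move=> eH; rewrite in_active !in_wball /opens /closes eH negb_and -ltNge -leNgt.
case/orP; last by move=> ? _; lra.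
by rewrite lt_min => /andP[? ?] /orP[] /andP[_ ?]; lra.
Qed.

Lemma wball_exit r a b e : a \in wball r -> b \in H -> b \notin wball r ->
  (src e == a) && (tgt e == b) || (src e == b) && (tgt e == a) ->
  e \in active opens closes r.
Proof.
rewrite in_active !in_wball => /andP[aH ar] bH; rewrite bH /= -ltNge => rb eab.
have eH : e \in inner_edges H.
  by rewrite in_inner_edges; case/orP: eab => /andP[/eqP-> /eqP->]; rewrite aH bH.
have [h1 h2] := wdist_edge eH.
rewrite /opens /closes eH ge_min.
by case/orP: eab h1 h2 => /andP[/eqP-> /eqP->] h1 h2; rewrite ar ?orbT /=; lra.
Qed.

Lemma no_open_edge r : 0 <= r -> active opens closes r = finset.set0 -> wball r = H.
Proof.
move=> r0 none; apply/eqP; rewrite finset.eqEsubset; apply/andP; split.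
  by apply/fintype.subsetP => v; rewrite in_wball => /andP[].
apply/fintype.subsetP => z zH; apply/negPn/negP => zB.
have xB : x \in wball r by rewrite in_wball mem_component //= /d wdist_refl.
move: (zH); rewrite inE => /andP[_ xz].
have [a [b [aB bB /[dup] ab /and3P[_ _ /existsP[[e o] /andP[/eqP da /eqP db]]]]]] := connect_exit xz xB zB.
have aH : a \in H by move: aB; rewrite in_wball => /andP[].
have bH : b \in H by exact: component_adj aH ab.
suff : e \in active opens closes r by rewrite none inE.
by apply: wball_exit aB bH bB _; move: da db; rewrite /dart_src /dart_tgt /=;
  case: o => /= -> ->; rewrite !eqxx ?orbT.
Qed.

(** While the component is not exhausted, an edge sticks out, so the covered length
    is at least the radius and reaches [4 m]. If from then on more than a quarter
    of the covered length stuck out at every radius, the covered length would double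
    in every step of length 4 and exceed the total length after [k] steps. *)
Lemma sparse_radius (m k : nat) : (0 < m)%N -> \sum_e len e < (4 * m)%:R * 2 ^+ k ->
  exists r, [/\ 0 <= r, r <= (4 * m + 4 * k)%:R &
    wball r = H /\ active opens closes r = finset.set0 \/
    (2 * m)%:R <= vol (wball r) /\ #|active opens closes r|%:R <= vol (wball r) / 2].
Proof.
move=> m0 lenk.
have [[r /andP[r0 rm] none]|some] := pselect (exists2 r, 0 <= r < (4 * m)%:R & active opens closes r = finset.set0).
  exists r; split => //; first by apply: le_trans (ltW rm) _; rewrite ler_nat leq_addr.
  by left; split => //; exact: no_open_edge.
have base : (4 * m)%:R <= covered opens closes (4 * m)%:R.
  have := @covered_growth R E opens closes 1 0 (4 * m)%:R.
  rewrite mul1r subr0 => h; apply: le_trans (h _ _) => //.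
    by rewrite lerDr; apply: sumr_ge0 => e _; rewrite le_max lexx.
  by move=> t tm; rewrite ler1n card_gt0; apply/eqP => t0; apply: some; exists t.
have [[r /andP[r0 rk] few]|many] := pselect (exists2 r, (4 * m)%:R <= r < (4 * m + 4 * k)%:R & #|active opens closes r|%:R <= covered opens closes r / 4).
  exists r; split; [exact: le_trans r0|exact: ltW|right].
  have := covered_homo opens closes r0; have := covered_le_vol r.
  move: base few; rewrite !natrM; set F := covered _ _ _; set W := vol _ => *; split; lra.
have grow j : (j <= k)%N -> (4 * m)%:R * 2 ^+ j <= covered opens closes (4 * m + 4 * j)%:R.
  elim: j => [_|j IH jk]; first by rewrite expr0 mulr1 muln0 addn0.
  have {}IH := IH (ltnW jk).
  set F := covered _ _ (4 * m + 4 * j)%:R in IH.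
  have := @covered_growth R E opens closes (F / 4) (4 * m + 4 * j)%:R (4 * m + 4 * j.+1)%:R.
  have -> : (4 * m + 4 * j.+1)%:R - (4 * m + 4 * j)%:R = 4 :> R.
    by rewrite !natrD !natrM -natr1; lra.
  rewrite ler_nat leq_add2l leq_mul2l leqnSn /= => /(_ isT) h.
  rewrite exprS mulrCA; apply: le_trans (h _); last first.
    move=> t /andP[t1 t2]; apply: (@le_trans _ _ (covered opens closes t / 4)).
      by rewrite ler_pM2r ?invr_gt0 //; exact: covered_homo.
    rewrite leNgt; apply/negP => few; apply: many; exists t; last exact: ltW.
    apply/andP; split; first by apply: le_trans t1; rewrite ler_nat leq_addr.
    by apply: lt_le_trans t2 _; rewrite ler_nat leq_add2l leq_mul2l.
  rewrite -/F divfK //; lra.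
have := le_lt_trans (le_trans (grow k (leqnn k)) (covered_le_len _)) lenk.
by rewrite ltxx.
Qed.

End Ball.
(** * Removing balls *)

(** The cardinalities say that the graph with vertices [X] and edges [S] has first
    Betti number at least [n]. The walks to the vertices of [X] may use any edges of
    the whole graph. *)
Definition rich_region (n : nat) (L : R) := exists x (X : {set V}) (S : {set E}) P,
  [/\ forall v, v \in X -> walk [set: V] x (P v) v, x \in X, S \subset inner_edges X,
      forall e, e \in S -> wlen (P (src e)) + len e + wlen (P (tgt e)) <= L
    & (#|X| + n <= #|S| + 1)%N].

(** Only vertices in components of volume above [n - 1] call for further balls; a
    smaller component is absorbed as soon as a ball cuts it off. *)
Definition bulky (n : nat) U : {set V} := [set v in U | n.-1%:R < vol (component U v)].

Lemma in_bulky n U v : (v \in bulky n U) = (v \in U) && (n.-1%:R < vol (component U v)).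
Proof. by rewrite inE. Qed.

Lemma bulky_sub n (U U' : {set V}) : U \subset U' -> bulky n U \subset bulky n U'.
Proof.
move=> UU'; apply/fintype.subsetP => v; rewrite !inE => /andP[/(fintype.subsetP UU')-> /=].
by move/lt_le_trans; apply; exact/vol_sub/component_sub.
Qed.

Lemma len_vol U e v : v \in U -> (src e == v) || (tgt e == v) ->
  len e <= 2 * vol (component U v).
Proof.
move=> vU /len_mass/le_trans; apply; rewrite ler_pM2l // /vol (bigD1 v) ?mem_component //=.
by rewrite lerDl; apply: sumr_ge0 => *; exact: mass_ge0.
Qed.

(** Induction on [U]: remove a sparse ball [B] centred at a bulky vertex. The set
    [X] of the vertices that stop being bulky consists of [B] and of vertices in
    pieces of volume at most [n - 1] that touch [B]; hence all of it is within
    [2 (n - 1)] of [B], and every edge between [X] and the vertices that stay bulky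
    sticks out of [B]. The edges inside [X] that do not stick out of [B] cannot
    form a rich region. *)
Lemma bulky_bound (n k : nat) L : (0 < n)%N -> \sum_e len e < (4 * n)%:R * 2 ^+ k ->
  2 * ((4 * n + 4 * k)%:R + 1) + 6 * n.-1%:R <= L -> ~ rich_region n L ->
  forall U, bulky n U != finset.set0 ->
    #|inner_edges (bulky n U)|%:R - #|bulky n U|%:R < vol (bulky n U) - 1.
Proof.
move=> n0 lenk LL no_rich U; have [m] := ubnP #|U|; elim: m U => // m IH U.
rewrite ltnS => Um /set0Pn[x xUb].
have [xU xbig] : x \in U /\ n.-1%:R < vol (component U x) by move: xUb; rewrite in_bulky => /andP[].
have [r [r0 rk fewE]] := sparse_radius xU n0 lenk.
set B := wball U x r in fewE; set A := active _ _ r in fewE.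
have BH : B \subset component U x by apply/fintype.subsetP => v; rewrite in_wball => /andP[].
have BU : B \subset U by exact: fintype.subset_trans BH (component_subset _ _).
have xB : x \in B by rewrite in_wball mem_component //= wdist_refl.
pose U' := U :\: B.
have U'U : U' \subset U by exact: finset.subsetDl.
have U'm : (#|U'| < m)%N.
  apply: leq_trans Um; apply/proper_card/properP; split => //.
  by exists x => //; rewrite finset.in_setD xB.
(* Y' is what stays bulky, X below is what is removed *)
set Y' := bulky n U'; set Y := bulky n U.
have Y'Y : Y' \subset Y by exact: bulky_sub.
have IHY : #|inner_edges Y'|%:R - #|Y'|%:R <= vol Y'.
  have [->|Y'0] := eqVneq Y' finset.set0.
    rewrite (_ : inner_edges finset.set0 = finset.set0) ?cards0 ?subrr ?vol_ge0 //.
    by apply/setP => e; rewrite !inE.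
  by have := IH _ U'm Y'0; rewrite -/Y'; lra.
pose X := Y :\: Y'.
have YU : Y \subset U by apply/fintype.subsetP => v; rewrite in_bulky => /andP[].
have BX : B \subset X.
  apply/fintype.subsetP => v vB; rewrite finset.in_setD !in_bulky finset.in_setD vB /= (fintype.subsetP BU) //=.
  by rewrite (component_mem (fintype.subsetP BH _ vB)).
have xX : x \in X by exact: fintype.subsetP BX _ xB.
have near_ball v : v \in X -> v \notin B ->
  2 * vol (component U' v) <= 2 * n.-1%:R /\
  exists2 p, walk U x p v & wlen p <= r + 1 + 2 * n.-1%:R.
  move=> vX vB; have vY : v \in Y by move: vX; rewrite finset.in_setD => /andP[].
  have vU : v \in U by exact: (fintype.subsetP YU).
  have vU' : v \in U' by rewrite finset.in_setD vB.
  have small : vol (component U' v) <= n.-1%:R.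
    by move: vX; rewrite finset.in_setD vY andbT in_bulky vU' -leNgt.
  split; first by rewrite ler_pM2l.
  have big : n.-1%:R < vol (component U v) by move: vY; rewrite in_bulky => /andP[].
  have /fintype.subsetPn[z zv zv'] : ~~ (component U v \subset component U' v).
    apply/negP => /vol_sub; lra.
  move: zv; rewrite inE => /andP[_ vz].
  have [a [b [av bv ab]]] := connect_exit vz (mem_component vU') zv'.
  have bB : b \in B.
    apply/negPn/negP => bB; move/negP: bv; apply; apply: (component_adj av).
    case/and3P: ab => aU bU h; rewrite /adj (finset.in_setD _ _ b) bB bU h !andbT.
    exact: fintype.subsetP (component_subset _ _) _ av.
  have [q wq lq] := short_walk vU' av.
  have bH := fintype.subsetP BH _ bB.
  have [p wp lp] := wdist_adherent ltr01 bH xU.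
  case/and3P: ab => aU bU /existsP[d /andP[/eqP da /eqP db]].
  (* from x to the end b in the ball of an edge d, then across d and, inside the
     small piece, to v; the mass of a pays for d *)
  exists (p ++ rev_walk (q ++ [:: d])).
    apply: walk_cat wp (walk_rev _); rewrite -db; apply: walk_cat (walk_sub U'U wq) _.
    by rewrite -da; apply: walk1; rewrite ?da ?db.
  rewrite wlen_cat wlen_rev wlen_cat {3}/wlen big_seq1.
  have ld : len d.1 <= 2 * mass a.
    apply: len_mass; move: da; rewrite /dart_src.
    by case: d.2 => ->; rewrite eqxx ?orbT.
  by move: bB; rewrite in_wball => /andP[_ br]; lra.
have reach v : exists p, v \in X -> walk U x p v /\
    (if v \in B then wlen p <= wdist U x v + 1 else wlen p <= r + 1 + 2 * n.-1%:R).
  have [vX|] := boolP (v \in X); last by exists [::].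
  have [vB|vB] := boolP (v \in B).
    have [p wp lp] := wdist_adherent ltr01 (fintype.subsetP BH _ vB) xU.
    by exists p => _; split => //; exact: ltW.
  by have [_ [p wp lp]] := near_ball v vX vB; exists p.
have [P Pwalk] := choice reach.
pose S := inner_edges X :\: A.
have Plen v : v \in X -> wlen (P v) <= r + 1 + 2 * n.-1%:R.
  move=> /Pwalk[_]; case: ifP => // vB.
  have n1 : 0 <= n.-1%:R :> R by [].
  by move: vB; rewrite in_wball => /andP[_ vr]; lra.
(* otherwise x, X and S would be a rich region *)
have cardS : (#|S| + 2 <= #|X| + n)%N.
  rewrite addnS -ltnS ltnS ltnNge; apply/negP => big; apply: no_rich; exists x, X, S, P; split => //.
  - by move=> v /Pwalk[w _]; apply: walk_sub w; exact: finset.subsetT.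
  - exact: finset.subsetDl.
  move=> e; rewrite finset.in_setD => /andP[eA /[dup] eX]; rewrite in_inner_edges => /andP[sX tX].
  have n1 : 0 <= n.-1%:R :> R by [].
  have [/andP[sB tB]|] := boolP ((src e \in B) && (tgt e \in B)).
    have eH : e \in inner_edges (component U x) by rewrite in_inner_edges !(fintype.subsetP BH).
    have := wball_closed eH eA; rewrite -/B sB => /(_ isT).
    by have [_] := Pwalk _ sX; have [_] := Pwalk _ tX; rewrite sB tB; lra.
  rewrite negb_and => outB.
  have le1 : len e <= 2 * n.-1%:R.
    have inU' v : v \in X -> v \notin B -> v \in U'.
      by rewrite !finset.in_setD => /andP[_ /(fintype.subsetP YU)->] ->.
    by case/orP: outB => vB; [have [h _] := near_ball _ sX vB|have [h _] := near_ball _ tX vB];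
      apply: le_trans h; apply: len_vol; rewrite ?inU' ?eqxx ?orbT.
  by have := Plen _ sX; have := Plen _ tX; lra.
have mixed e a b : a \in X -> b \in Y' ->
    (src e == a) && (tgt e == b) || (src e == b) && (tgt e == a) -> e \in A.
  move=> aX bY' eab.
  have bU' : b \in U' by move: bY'; rewrite in_bulky => /andP[].
  have aY : a \in Y by move: aX; rewrite finset.in_setD => /andP[].
  have ab (W : {set V}) : a \in W -> b \in W -> adj W a b.
    move=> aW bW; rewrite /adj aW bW /=; apply/existsP.
    by case/orP: eab => /andP[/eqP es /eqP et]; [exists (e, true)|exists (e, false)];
      rewrite /dart_src /dart_tgt /= es et !eqxx.
  have aB : a \in B.
    apply/negPn/negP => aB.
    have aU' : a \in U' by rewrite finset.in_setD aB (fintype.subsetP YU).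
    move: aX; rewrite finset.in_setD => /andP[/negP h _]; apply: h.
    by move: bY'; rewrite !in_bulky (component_eq (ab _ aU' bU')) aU' => /andP[_].
  have bB : b \notin B by move: bU'; rewrite finset.in_setD => /andP[].
  apply: (@wball_exit U x xU r a b e aB _ bB eab).
  apply: component_adj (fintype.subsetP BH _ aB) (ab _ _ _); first exact: (fintype.subsetP YU).
  exact: (fintype.subsetP U'U).
have cover : inner_edges Y \subset inner_edges Y' :|: (S :|: A).
  apply/fintype.subsetP => e; rewrite in_inner_edges => /andP[sY tY].
  rewrite finset.in_setU finset.in_setU finset.in_setD !in_inner_edges !(finset.in_setD Y Y').
  have [eA|eA] := boolP (e \in A); first by rewrite !orbT.
  rewrite orbF /= sY tY.
  have [sY'|sY'] := boolP (src e \in Y'); have [tY'|tY'] := boolP (tgt e \in Y') => //=.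
  - by case/negP: eA; apply: (@mixed e (tgt e) (src e)); rewrite ?finset.in_setD ?tY' ?tY // !eqxx orbT.
  - by case/negP: eA; apply: (@mixed e (src e) (tgt e)); rewrite ?finset.in_setD ?sY' ?sY // !eqxx.
have cardE : (#|inner_edges Y| <= #|inner_edges Y'| + (#|S| + #|A|))%N.
  apply: leq_trans (subset_leq_card cover) _.
  by apply: leq_trans (leq_card_setU _ _) _; rewrite leq_add2l; exact: leq_card_setU.
have cardV : #|Y| = (#|Y'| + #|X|)%N by rewrite -(cardsID Y' Y) (finset.setIidPr Y'Y).
have volY : vol Y = vol Y' + vol X by exact: volD.
have volB : vol B <= vol X by exact: vol_sub.
have n1 : n%:R = n.-1%:R + 1 :> R by rewrite natr1 prednK.
move: cardE cardS; rewrite -!(ler_nat R) cardV volY !natrD.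
case: fewE => [[BHe A0]|[]].
  have hb : n.-1%:R < vol B by rewrite BHe.
  by rewrite A0 cards0 n1; lra.
by rewrite natrM; lra.
Qed.

Definition independent_walks (n : nat) (w : 'I_n -> seq (E * bool)) :=
  forall a : 'I_n -> R, (forall e, \sum_i a i * wcount (w i) e = 0) -> forall i, a i = 0.

(** The matrix [A] of the edge counts of the loops is [D + M N], where the rows of
    [D] are the distinct basis vectors of the edges of [S], and [M N] has rank less
    than [#|X|] since it factors through the walks to the vertices other than [x];
    the walk to [x] itself is taken to be empty. Any family of rows of [A] that is
    maximal independent is then large enough. *)
Lemma rich_region_loops (n : nat) L : rich_region n L ->
  exists x (w : 'I_n -> seq (E * bool)),
    [/\ forall i, walk [set: V] x (w i) x, forall i, wlen (w i) <= L & independent_walks w].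
Proof.
case=> x [X [S [P0 [P0walk xX SX P0len card]]]].
pose P v := if v == x then [::] else P0 v.
have Pwalk v : v \in X -> walk [set: V] x (P v) v.
  move=> vX; rewrite /P; case: eqP => [->|_]; last exact: P0walk.
  by rewrite /= eqxx inE.
have Plen v : wlen (P v) <= wlen (P0 v).
  by rewrite /P; case: eqP => // _; rewrite {1}/wlen big_nil wlen_ge0.
pose loop e := P (src e) ++ ((e, true) :: rev_walk (P (tgt e))).
pose A : 'M[R]_(#|S|, #|E|) := \matrix_(i, j) wcount (loop (enum_val i)) (enum_val j).
pose D : 'M[R]_(#|S|, #|E|) := \matrix_(i, j) (enum_val i == enum_val j)%:R.
pose M : 'M[R]_(#|S|, #|X :\ x|) :=
  \matrix_(i, j) ((src (enum_val i) == enum_val j)%:R - (tgt (enum_val i) == enum_val j)%:R).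
pose N : 'M[R]_(#|X :\ x|, #|E|) := \matrix_(i, j) wcount (P (enum_val i)) (enum_val j).
have sum_P v e : v \in X ->
    \sum_(j < #|X :\ x|) (v == enum_val j)%:R * wcount (P (enum_val j)) e = wcount (P v) e.
  move=> vX; rewrite -(big_enum_val (fun z => (v == z)%:R * wcount (P z) e)) /=.
  have [->|vx] := eqVneq v x.
    rewrite {2}/P eqxx {2}/wcount big_nil big1 // => z; rewrite !inE => /andP[zx _].
    by rewrite eq_sym (negPf zx) mul0r.
  rewrite (bigD1 v) ?inE ?vx //= eqxx mul1r big1 ?addr0 // => z /andP[_ zv].
  by rewrite eq_sym (negPf zv) mul0r.
have ADQ : D = A + - (M *m N).
  apply/matrixP => i j; rewrite !mxE.
  have /andP[sX tX] : (src (enum_val i) \in X) && (tgt (enum_val i) \in X).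
    by rewrite -in_inner_edges (fintype.subsetP SX) // enum_valP.
  under eq_bigr do rewrite !mxE mulrBl.
  rewrite sumrB !sum_P // /loop wcount_cat -cat1s wcount_cat wcount_rev.
  rewrite {2}/wcount big_seq1 /=; case: eqP => _ /=; ring.
have rankD : (\rank D = #|S|)%N.
  apply/eqP/row_freeP; exists D^T; apply/matrixP => i j; rewrite !mxE.
  rewrite (bigD1 (enum_rank (enum_val i))) //= !mxE enum_rankK eqxx mul1r.
  rewrite (inj_eq enum_val_inj) eq_sym big1 ?addr0 // => l li.
  rewrite !mxE; case: eqP => [h|]; last by rewrite mul0r.
  by move: li; rewrite h enum_valK eqxx.
have rankQ : (\rank (- (M *m N)) <= #|X|.-1)%N.
  rewrite mxrank_opp; apply: leq_trans (mxrankM_maxl _ _) _.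
  by apply: leq_trans (rank_leq_col _) _; rewrite [#|X|](cardsD1 x) xX.
have rankA : (n <= \rank A)%N.
  have X0 : (0 < #|X|)%N by apply/card_gt0P; exists x.
  have := leq_trans (mxrank_add A (- (M *m N))) (leq_add (leqnn _) rankQ).
  rewrite -ADQ rankD; lia.
pose f i := maxrankfun A (widen_ord rankA i).
exists x, (fun i => loop (enum_val (f i))); split.
- move=> i; have /andP[sX tX] : (src (enum_val (f i)) \in X) && (tgt (enum_val (f i)) \in X).
    by rewrite -in_inner_edges (fintype.subsetP SX) // enum_valP.
  apply: walk_cat (Pwalk _ sX) _; rewrite /= inE eqxx /=.
  exact: walk_rev (Pwalk _ tX).
- move=> i; rewrite /loop wlen_cat -cat1s wlen_cat wlen_rev {2}/wlen big_seq1 /= addrA.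
  by apply: le_trans (P0len _ (enum_valP (f i))); rewrite !lerD.
move=> a a0 i.
pose u : 'rV[R]_(\rank A) := \sum_i a i *: delta_mx 0 (widen_ord rankA i).
have u0 : u *m rowsub (maxrankfun A) A = 0.
  rewrite mulmx_suml; apply/rowP => j; rewrite summxE mxE -[RHS](a0 (enum_val j)).
  by apply: eq_bigr => l _; rewrite -scalemxAl -rowE !mxE.
have := row_free_inj (maxrowsub_free A) (etrans u0 (esym (mul0mx _ _))).
move/rowP/(_ (widen_ord rankA i)); rewrite summxE !mxE => <-.
rewrite (bigD1 i) //= !mxE !eqxx mulr1 big1 ?addr0 // => j ji.
rewrite !mxE eqxx /=; case: eqP => [/(congr1 val)/= ij|]; last by rewrite mulr0.
by case/eqP: ji; apply: val_inj.
Qed.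

(** If all vertices are bulky, [bulky_bound] for the whole graph contradicts the
    Euler characteristic; if none is, the whole graph has volume at most [n - 1] and is
    itself a rich region. *)
Lemma rich_region_exists (b n k : nat) (x0 : V) :
  (forall x y, connect (adj [set: V]) x y) -> \sum_e len e <= b%:R ->
  (#|E| + 1 = b + #|V|)%N -> (0 < n <= b)%N -> (b <= 2 ^ k)%N ->
  rich_region n (2 * ((4 * n + 4 * k)%:R + 1) + 6 * n.-1%:R).
Proof.
move=> conn lenb euler /andP[n0 nb] bk; set L := (X in rich_region n X).
have compT x : component [set: V] x = [set: V] by apply/setP => z; rewrite !inE conn.
have innerT : inner_edges [set: V] = [set: E] by apply/setP => e; rewrite !inE.
have b0 : (0 < b)%N by exact: leq_trans nb.
have lenk : \sum_e len e < (4 * n)%:R * 2 ^+ k.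
  apply: le_lt_trans lenb _; rewrite -natrX -natrM ltr_nat; nia.
apply: contrapT => no_rich.
have bulkyT v : v \in bulky n [set: V] = (n.-1%:R < vol [set: V]).
  by rewrite in_bulky inE compT.
have [small|big] := leP (vol [set: V]) n.-1%:R; last first.
  have bT : bulky n [set: V] = [set: V] by apply/setP => v; rewrite bulkyT big inE.
  have := bulky_bound n0 lenk (lexx _) no_rich (U := [set: V]).
  rewrite bT innerT vol_setT !cardsT => /(_ _)/wrap[].
    by apply/set0Pn; exists x0; rewrite inE.
  have : #|E|%:R + 1 = b%:R + #|V|%:R :> R by rewrite -natrD -euler natrD.
  by lra.
apply: no_rich.
have reach v : exists p, walk [set: V] x0 p v /\ wlen p <= 2 * n.-1%:R.
  have x0T : x0 \in [set: V] by rewrite inE.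
  have vT : v \in component [set: V] x0 by rewrite compT inE.
  have [p wp lp] := short_walk x0T vT.
  exists p; split => //; move: lp; rewrite compT; have := mass_ge0 v; lra.
have [P Pwalk] := choice reach.
exists x0, [set: V], [set: E], P; split.
- by move=> v _; have [] := Pwalk v.
- by rewrite inE.
- by rewrite innerT.
- move=> e _; have [_ ls] := Pwalk (src e); have [_ lt] := Pwalk (tgt e).
  have le : len e <= 2 * vol [set: V].
    by rewrite -(compT (src e)); apply: len_vol; rewrite ?inE ?eqxx.
  by rewrite /L; have : 0 <= (4 * n + 4 * k)%:R :> R by []; lra.
by rewrite !cardsT; lia.
Qed.

End Graph.

Local Open Scope classical_set_scope.
Local Open Scope ring_scope.

(** * Concatenation and length of curves *)

Lemma within_continuous_ballP (R : realType) (X Y : pseudoMetricType R) (A : set X) (f : X -> Y) :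
  {within A, continuous f} <->
  forall x, A x -> forall eps : R, 0 < eps ->
    exists2 dt : R, 0 < dt & forall y, A y -> ball x dt y -> ball (f x) eps (f y).
Proof.
rewrite subspace_continuousP; split=> cf x Ax.
  move=> eps eps0; have /cvg_ballP/(_ _ eps0) := cf x Ax.
  by rewrite near_withinE near_simpl => /nbhs_ballP[dt dt0 h]; exists dt => // y Ay /h; exact.
apply/cvg_ballP => eps /(cf x Ax)[dt dt0 h].
by rewrite near_withinE near_simpl; apply/nbhs_ballP; exists dt => // y xy Ay; exact: h.
Qed.

Section Concatenation.
Variables (R : realType) (X : pseudoMetricType R).
Implicit Types g h : R -> X.

Definition rev_curve g : R -> X := fun t => g (1 - t).

Definition cat_curve g h : R -> X :=
  fun t => if t <= 1 / 2 then g (2 * t) else h (2 * t - 1).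

Lemma rev_curve0 g : rev_curve g 0 = g 1.
Proof. by rewrite /rev_curve subr0. Qed.

Lemma rev_curve1 g : rev_curve g 1 = g 0.
Proof. by rewrite /rev_curve subrr. Qed.

Lemma cat_curve0 g h : cat_curve g h 0 = g 0.
Proof. by rewrite /cat_curve mulr0 ifT //; lra. Qed.

Lemma cat_curve1 g h : cat_curve g h 1 = h 1.
Proof. by rewrite /cat_curve ifF; [rewrite mulr1 addrK|apply/negbTE; rewrite -ltNge; lra]. Qed.

Lemma continuous_rev_curve g :
  {within `[0, 1], continuous g} -> {within `[0, 1], continuous (rev_curve g)}.
Proof.
move/within_continuous_ballP=> cg; apply/within_continuous_ballP => t t01 eps eps0.
have [|dt dt0 h] := cg (1 - t) _ _ eps0.
  by move: t01; rewrite /= !in_itv /= => /andP[? ?]; apply/andP; split; lra.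
exists dt => // s s01 ts; apply: h.
  by move: s01; rewrite /= !in_itv /= => /andP[? ?]; apply/andP; split; lra.
by move: ts; rewrite /ball /= (_ : 1 - t - (1 - s) = s - t); [rewrite distrC|ring].
Qed.

Lemma continuous_cat_curve g h : g 1 = h 0 ->
  {within `[0, 1], continuous g} -> {within `[0, 1], continuous h} ->
  {within `[0, 1], continuous (cat_curve g h)}.
Proof.
move=> gh /within_continuous_ballP cg /within_continuous_ballP ch.
apply/within_continuous_ballP => t; rewrite /= in_itv /= => /andP[t0 t1] eps eps0.
rewrite /cat_curve.
case: (ltrgtP t (1 / 2)) => [t2|t2|t2].
- have [|dt dt0 hg] := cg (2 * t) _ _ eps0; first by rewrite /= in_itv /=; lra.
  exists (Num.min (dt / 2) (1 / 2 - t)); first by rewrite lt_min; lra.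
  move=> s; rewrite /= in_itv /= /ball /= => /andP[s0 s1]; rewrite lt_min => /andP[].
  rewrite !ltr_norml => /andP[? ?] /andP[? ?]; rewrite ifT; last by lra.
  apply: hg; first by rewrite /= in_itv /=; lra.
  by rewrite /ball /= ltr_norml; lra.
- have [|dt dt0 hh] := ch (2 * t - 1) _ _ eps0; first by rewrite /= in_itv /=; lra.
  exists (Num.min (dt / 2) (t - 1 / 2)); first by rewrite lt_min; lra.
  move=> s; rewrite /= in_itv /= /ball /= => /andP[s0 s1]; rewrite lt_min => /andP[].
  rewrite !ltr_norml => /andP[? ?] /andP[? ?]; rewrite ifF; last by apply/negbTE; rewrite -ltNge; lra.
  apply: hh; first by rewrite /= in_itv /=; lra.
  by rewrite /ball /= ltr_norml; lra.
have [|dg dg0 hg] := cg 1 _ _ eps0; first by rewrite /= in_itv /=; lra.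
have [|dh dh0 hh] := ch 0 _ _ eps0; first by rewrite /= in_itv /=; lra.
exists (Num.min dg dh / 2); first by rewrite divr_gt0 // lt_min dg0.
move=> s; rewrite /= in_itv /= /ball /= => /andP[s0 s1].
rewrite ltr_pdivlMr // lt_min => /andP[].
rewrite -[2 in X in X -> _](@ger0_norm R 2) // -normrM !ltr_norml => /andP[? ?].
rewrite -[2 in X in X -> _](@ger0_norm R 2) // -normrM !ltr_norml => /andP[? ?].
have -> : 2 * t = 1 by lra.
case: ifP => s2.
  by apply: hg; [rewrite /= in_itv /=; lra|rewrite /ball /= ltr_norml; lra].
rewrite gh; apply: hh; [rewrite /= in_itv /=|rewrite /ball /= ltr_norml]; move/negbT: s2; rewrite -ltNge; lra.
Qed.

End Concatenation.

Section Curves.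
Variables (R : realType) (T : metricType R).
Implicit Types (g h : R -> T) (x y z : T).

(** Subdivisions are given as monotone sequences, which may repeat points, so that a
    subdivision of a concatenation induces one of each part by clamping. *)
Definition variation_le g (M : R) := forall (t : nat -> R) k,
  (forall i, 0 <= t i <= 1) -> {homo t : i j / (i <= j)%N >-> i <= j} ->
  \sum_(i < k) mdist (g (t i)) (g (t i.+1)) <= M.

Lemma nth_itv_partition (s : seq R) : itv_partition 0 1 s ->
  (forall i, 0 <= nth 1 (0 :: s) i <= 1) /\
  {homo nth 1 (0 :: s) : i j / (i <= j)%N >-> i <= j}.
Proof.
case=> ps /eqP ls.
have srt : sorted <=%R (0 :: s) by apply: sub_path ps => a b /ltW.
have bnd i : 0 <= nth 1 (0 :: s) i <= 1.
  have [is_|is_] := ltnP i (size (0 :: s)); last by rewrite nth_default ?ler01 ?lexx.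
  apply/andP; split.
    by have := sorted_leq_nth le_trans le_refl 1 srt (0 : nat) i; rewrite !inE; apply.
  have := sorted_leq_nth le_trans le_refl 1 srt i (size s); rewrite !inE /= ltnSn.
  by rewrite nth_last /= ls; apply.
split=> // i j ij.
have [js|js] := ltnP j (size (0 :: s)); last first.
  by rewrite [leRHS]nth_default //; case/andP: (bnd i).
by apply: (sorted_leq_nth le_trans le_refl 1 srt) => //; rewrite !inE; exact: leq_ltn_trans js.
Qed.

Lemma variation_le_curve_length g M : variation_le g M -> (curve_length g <= M%:E)%E.
Proof.
move=> gM; apply: ge_ereal_sup => _ [s /nth_itv_partition[s01 homo_s] <-].
by rewrite lee_fin /polygonal_length big_mkord; exact: gM.
Qed.

Lemma variation_le_rev g M : variation_le g M -> variation_le (rev_curve g) M.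
Proof.
move=> gM t k t01 homo_t.
rewrite (reindex_inj rev_ord_inj) /=.
rewrite (eq_bigr (fun i : 'I_k => mdist (g (1 - t (k - i)%N)) (g (1 - t (k - i.+1)%N)))).
  apply: (gM (fun i => 1 - t (k - i)%N)) => [i|i j ij].
    by have /andP[? ?] := t01 (k - i)%N; apply/andP; split; lra.
  by have := homo_t _ _ (leq_sub2l k ij); lra.
move=> i _; rewrite metric_sym /rev_curve subnSK //.
Qed.

(** Clamping the subdivision to each half bounds the sum term by term; only the term
    that straddles the junction needs the triangle inequality. *)
Lemma variation_le_cat g h M N : g 1 = h 0 -> variation_le g M -> variation_le h N ->
  variation_le (cat_curve g h) (M + N).
Proof.
move=> gh gM hN t k t01 homo_t.
pose u i := Num.min (2 * t i) 1; pose v i := Num.max (2 * t i - 1) 0.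
have u01 i : 0 <= u i <= 1.
  have /andP[? ?] := t01 i; rewrite /u le_min ge_min ler01 lexx orbT !andbT; lra.
have v01 i : 0 <= v i <= 1.
  have /andP[? ?] := t01 i; rewrite /v ge_max le_max ler01 lexx orbT !andbT; lra.
have homo_u : {homo u : i j / (i <= j)%N >-> i <= j}.
  by move=> i j /homo_t ij; rewrite /u le_min !ge_min lexx orbT andbT ler_pM2l ?ij.
have homo_v : {homo v : i j / (i <= j)%N >-> i <= j}.
  by move=> i j /homo_t ij; rewrite /v ge_max !le_max lexx orbT andbT lerD2r ler_pM2l ?ij.
apply: le_trans (lerD (gM u k u01 homo_u) (hN v k v01 homo_v)).
rewrite -big_split /=; apply: ler_sum => i _.
have := homo_t i i.+1 (leqnSn i); rewrite /u /v /cat_curve => tt.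
have minL (a : R) : a <= 1 -> Num.min a 1 = a by move/min_idPl.
have minR (a : R) : 1 <= a -> Num.min a 1 = 1 by move/min_idPr.
have maxL (a : R) : 0 <= a -> Num.max a 0 = a by move/max_idPl.
have maxR (a : R) : a <= 0 -> Num.max a 0 = 0 by move/max_idPr.
case: (leP (t i) (1 / 2)) => h1; case: (leP (t i.+1) (1 / 2)) => h2.
- rewrite (minL (2 * t i)) ?(minL (2 * t i.+1)) ?lerDl ?mdist_ge0 //; lra.
- rewrite (minL (2 * t i)) ?(minR (2 * t i.+1)) ?(maxR (2 * t i - 1)) ?(maxL (2 * t i.+1 - 1)); [|lra..].
  by apply: le_trans (metric_triangle _ (g 1) _) _; rewrite {2}gh.
- by have := le_trans tt h2; rewrite leNgt h1.
by rewrite (maxL (2 * t i - 1)) ?(maxL (2 * t i.+1 - 1)) ?lerDr ?mdist_ge0 //; lra.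
Qed.

Lemma variation_le_cst x : variation_le (fun=> x) 0.
Proof. by move=> t k _ _; rewrite big1 // => i _; rewrite mdistxx. Qed.

Lemma is_curve_rev x y g : is_curve x y g -> is_curve y x (rev_curve g).
Proof.
by case=> cg g0 g1; split; rewrite ?rev_curve0 ?rev_curve1 //; exact: continuous_rev_curve.
Qed.

Lemma is_curve_cst x : is_curve x x (fun=> x).
Proof. by split=> //; apply: continuous_subspaceT; exact: cst_continuous. Qed.

Lemma is_curve_cat x y z g h :
  is_curve x y g -> is_curve y z h -> is_curve x z (cat_curve g h).
Proof.
case=> cg g0 g1 [ch h0 h1]; split; rewrite ?cat_curve0 ?cat_curve1 //.
by apply: continuous_cat_curve => //; rewrite g1 h0.
Qed.

End Curves.

(** * Winding numbers *)

Section CircleFrac.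
Variable R : realType.
Implicit Types a b c : R.

(** The representative of [c] modulo 1 between -1/2 and 1/2; [`|cfrac (y - x)|] is the
    distance of [x] and [y] in the circle [R/Z]. *)
Definition cfrac c : R := c - (Num.floor (c + 1 / 2))%:~R.

Lemma cfrac_int c : cfrac c - c \is a Num.int.
Proof. by rewrite /cfrac addrAC subrr sub0r rpredN intr_int. Qed.

Lemma small_int c : c \is a Num.int -> `|c| < 1 -> c = 0.
Proof. by move=> /norm_intr_ge1 h; case: eqVneq h => // _ /(_ isT) /le_lt_trans h /h; rewrite ltxx. Qed.

Lemma cfrac_norm c : `|cfrac c| <= 1 / 2.
Proof.
rewrite /cfrac ler_norml; have /andP[] := floor_itv (c + 1 / 2); rewrite intrD.
by move=> *; apply/andP; split; lra.
Qed.

Lemma cfrac_small c a : a - c \is a Num.int -> `|a| < 1 / 2 -> cfrac c = a.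
Proof.
move=> ac a1; apply/subr0_eq/small_int; last first.
  by apply: le_lt_trans (ler_normB _ _) _; have := cfrac_norm c; lra.
by rewrite (_ : _ - _ = (cfrac c - c) - (a - c)); [rewrite rpredB // cfrac_int|ring].
Qed.

End CircleFrac.

Section Winding.
Variables (R : realType) (T : metricType R) (theta : T -> R).

(** A map to the circle is represented by a real function [theta], which need not be
    continuous, of which only the values modulo 1 matter. *)
Definition circle_continuous := forall x (eps : R), 0 < eps ->
  \forall y \near x, `|cfrac (theta y - theta x)| < eps.

(** For a loop this is the degree of the circle-valued map [theta \o g]; it is defined
    for open curves as well in order to be additive under concatenation. *)
Definition winding (g : R -> T) (w : R) := exists L : R -> R,
  [/\ {within `[0, 1], continuous L},
      forall t, 0 <= t <= 1 -> L t - theta (g t) \is a Num.int & w = L 1 - L 0].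

Lemma winding_uniq g w w' : winding g w -> winding g w' -> w = w'.
Proof.
case=> [L [cL Lg ->]] [L' [cL' L'g ->]].
pose D t := L t - L' t.
have Dint t : 0 <= t <= 1 -> D t \is a Num.int.
  move=> t01; rewrite (_ : D t = (L t - theta (g t)) - (L' t - theta (g t))); last by rewrite /D; ring.
  by rewrite rpredB ?Lg ?L'g.
have cD : {within `[0, 1], continuous D}.
  by move=> t; apply: cvgB; [exact: cL|exact: cL'].
have /connected_intervalP itvD := connected_continuous_connected (@segment_connected R 0 1) cD.
have h01 : (0 <= (0 : R) <= 1) /\ (0 <= (1 : R) <= 1) by lra.
suff : D 1 = D 0 by rewrite /D; lra.
apply/eqP; rewrite -subr_eq0; apply/negPn/negP => /(norm_intr_ge1 (rpredB (Dint _ h01.2) (Dint _ h01.1))) D1.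
have D0i : [set D t | t in `[0, 1]] (D 0) by exists 0 => //; rewrite /= in_itv /= lexx ler01.
have D1i : [set D t | t in `[0, 1]] (D 1) by exists 1 => //; rewrite /= in_itv /= lexx ler01.
(* by connectedness D would take a value halfway between two integers *)
have half c : [set D t | t in `[0, 1]] (c + 1 / 2) -> c \isn't a Num.int.
  case=> t; rewrite /= in_itv /= => t01 Dt; apply/negP => cint.
  have /small_int : (1 / 2 : R) \is a Num.int.
    by rewrite (_ : 1 / 2 = D t - c); [rewrite rpredB ?Dint|rewrite Dt; ring].
  by rewrite ger0_norm; lra.
move: D1; rewrite ler_normr => /orP[] D1.
  have /half : [set D t | t in `[0, 1]] (D 0 + 1 / 2) by apply: (itvD _ _ D0i D1i); lra.
  by rewrite Dint ?h01.1.
have /half : [set D t | t in `[0, 1]] (D 1 + 1 / 2) by apply: (itvD _ _ D1i D0i); lra.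
by rewrite Dint ?h01.2.
Qed.

Hypothesis theta_cont : circle_continuous.

Lemma simplex2_compact : compact (@simplex2 R).
Proof.
have square := compact_setX (@segment_compact R 0 1) (@segment_compact R 0 1).
apply: subclosed_compact square _.
- have -> : @simplex2 R = (fst @^-1` [set x | 0 <= x]) `&` (snd @^-1` [set x | 0 <= x]) `&`
      ((fun p => p.1 + p.2) @^-1` [set x | x <= 1]).
    by apply/seteqP; split=> p /=; [case|case=> -[]].
  apply: closedI; first apply: closedI.
  + by apply: closed_comp => [x _|]; [exact: cvg_fst|exact: closed_ge].
  + by apply: closed_comp => [x _|]; [exact: cvg_snd|exact: closed_ge].
  + apply: closed_comp => [x _|]; last exact: closed_le.
    by apply: cvgD; [exact: cvg_fst|exact: cvg_snd].
by move=> p [p1 p2 p12]; split; rewrite /= in_itv /=; lra.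
Qed.

Lemma simplex2_scale (p : R * R) (c : R) : simplex2 p -> 0 <= c <= 1 ->
  simplex2 (c * p.1, c * p.2).
Proof. by case=> p1 p2 p12 /andP[c0 c1]; split=> /=; rewrite ?mulr_ge0 -?mulrDr //; nra. Qed.

Section Simplex.
Variable sigma : R * R -> T.
Hypothesis sigma_cont : {within @simplex2 R, continuous sigma}.
Let f p := theta (sigma p).

Lemma simplex_circle_continuous p (eps : R) : simplex2 p -> 0 < eps ->
  exists2 dt : R, 0 < dt & forall q, simplex2 q -> ball p dt q -> `|cfrac (f q - f p)| < eps.
Proof.
move=> sp eps0; have /nbhs_ballP[e e0 he] := theta_cont (sigma p) eps0.
move/within_continuous_ballP: sigma_cont => /(_ p sp e e0)[dt dt0 h].
by exists dt => // q sq /(h q sq) /he.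
Qed.

Lemma simplex_unif_continuous : exists2 dt : R, 0 < dt &
  forall p q, simplex2 p -> simplex2 q -> ball p dt q -> `|cfrac (f q - f p)| < 1 / 8.
Proof.
have /compact_near_coveringP nc := simplex2_compact.
pose P (dt : R) p := forall q, simplex2 q -> ball p dt q -> `|cfrac (f q - f p)| < 1 / 8.
have near_P : \forall dt \near 0^'+, @simplex2 R `<=` (fun p => simplex2 p -> P dt p).
  apply: nc => p sp; have [|dt dt0 hdt] := @simplex_circle_continuous p (1 / 16) sp; first by lra.
  exists (ball p (dt / 2), [set e | e < dt / 2]); first split => /=.
  - by apply: nbhsx_ballx; rewrite divr_gt0.
  - by apply: nbhs_right_lt; rewrite divr_gt0.
  move=> [p' e] [/= pp' ee] sp' q sq p'q.
  have h1 := hdt p' sp' (le_ball (ltW (_ : dt / 2 < dt)) pp').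
  have h2 : `|cfrac (f q - f p)| < 1 / 16.
    apply: hdt => //; rewrite [dt]splitr; apply: ball_triangle pp' _.
    exact: le_ball (ltW ee) _ p'q.
  have {}h1 : `|cfrac (f p' - f p)| < 1 / 16 by apply: h1; lra.
  rewrite (@cfrac_small _ _ (cfrac (f q - f p) - cfrac (f p' - f p))).
  - by apply: le_lt_trans (ler_normB _ _) _; lra.
  - rewrite (_ : _ - _ = (cfrac (f q - f p) - (f q - f p)) - (cfrac (f p' - f p) - (f p' - f p))); last by ring.
    by rewrite rpredB // cfrac_int.
  - by apply: le_lt_trans (ler_normB _ _) _; lra.
have [dt [/= dt0 hdt]] := filter_ex (filterI (nbhs_right_gt (0 : R)) near_P).
by exists dt => // p q sp; exact: hdt.
Qed.

(** The lift is explicit: cut the segment from the origin to [p] into [N] pieces so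
    short that the circle-valued map moves by less than 1/8 along each, and add up the
    small representatives of its increments. When [p] moves to a nearby [q], the
    change of each increment is the difference of the small movements at the two ends
    of the piece, so that the sum telescopes to the movement between [p] and [q]. *)
Lemma simplex_lift : exists2 L : R * R -> R, {within @simplex2 R, continuous L} &
  forall p, simplex2 p -> L p - theta (sigma p) \is a Num.int.
Proof.
have [dt dt0 unif] := simplex_unif_continuous.
pose N := (Num.truncn dt^-1).+1.
have N0 : 0 < N%:R :> R by rewrite ltr0n.
have Ndt : N%:R^-1 < dt by rewrite -[dt]invrK ltf_pV2 ?posrE ?invr_gt0 //; exact: truncnS_gt.
pose pt (k : nat) (p : R * R) := (k%:R / N%:R * p.1, k%:R / N%:R * p.2).
have frac01 k : (k <= N)%N -> 0 <= (k%:R / N%:R : R) <= 1.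
  by move=> kN; rewrite divr_ge0 //= ler_pdivrMr // mul1r ler_nat.
have spt k p : (k <= N)%N -> simplex2 p -> simplex2 (pt k p).
  by move=> kN sp; exact: simplex2_scale (frac01 _ kN).
have ptN p : pt N p = p by rewrite /pt divff ?gt_eqF // !mul1r -surjective_pairing.
have pt0 p q : pt 0%N p = pt 0%N q by rewrite /pt !mul0r.
pose L p := f (0, 0) + \sum_(0 <= k < N) cfrac (f (pt k.+1 p) - f (pt k p)).
have f00 p : f (pt 0%N p) = f (0, 0) by rewrite /pt !mul0r.
exists L.
  apply/within_continuous_ballP => p sp eps eps0.
  have [d d0 hd] := simplex_circle_continuous sp eps0.
  exists (Num.min d dt); first by rewrite lt_min d0.
  move=> q sq pq; have pqd : ball p d q by apply: le_ball pq; rewrite ge_min lexx.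
  have pqdt : ball p dt q by apply: le_ball pq; rewrite ge_min lexx orbT.
  pose a k := cfrac (f (pt k q) - f (pt k p)).
  have a8 k : (k <= N)%N -> `|a k| < 1 / 8.
    move=> kN; apply: unif; [exact: spt|exact: spt|].
    have /andP[c0 c1] := frac01 _ kN.
    case: pqdt; rewrite /ball /= => h1 h2; split; rewrite /ball /= -mulrBr normrM (ger0_norm c0).
      by apply: le_lt_trans h1; rewrite ler_piMl.
    by apply: le_lt_trans h2; rewrite ler_piMl.
  have step8 s k : simplex2 s -> (k < N)%N -> `|cfrac (f (pt k.+1 s) - f (pt k s))| < 1 / 8.
    move=> ss kN; apply: unif; [exact/spt/ss/ltnW|exact: spt|].
    have st c : 0 <= c <= 1 -> `|k%:R / N%:R * c - k.+1%:R / N%:R * c| < dt.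
      move=> /andP[c0 c1].
      rewrite (_ : _ - _ = - (N%:R^-1 * c)); last by rewrite -natr1; ring.
      rewrite normrN ger0_norm ?mulr_ge0 ?invr_ge0 //.
      by apply: le_lt_trans Ndt; rewrite ler_piMr // invr_ge0.
    by case: ss => s1 s2 s12; split; rewrite /ball /=; apply: st; lra.
  have diff : L q - L p = cfrac (f q - f p).
    transitivity (\sum_(0 <= k < N) (a k.+1 - a k)).
      rewrite /L opprD addrACA subrr add0r -sumrB; apply: eq_big_nat => k /andP[_ kN].
      apply/subr0_eq/small_int.
        rewrite (_ : _ - _ =
          (cfrac (f (pt k.+1 q) - f (pt k q)) - (f (pt k.+1 q) - f (pt k q))) -
          (cfrac (f (pt k.+1 p) - f (pt k p)) - (f (pt k.+1 p) - f (pt k p))) -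
          (a k.+1 - (f (pt k.+1 q) - f (pt k.+1 p))) + (a k - (f (pt k q) - f (pt k p)))); last by ring.
        by apply: rpredD; [apply: rpredB; [apply: rpredB|]|]; exact: cfrac_int.
      have := step8 q k sq kN; have := step8 p k sp kN; have := a8 _ kN; have := a8 _ (ltnW kN).
      by rewrite !ltr_norml; lra.
    rewrite telescope_sumr // /a !ptN (pt0 q p) subrr (_ : cfrac 0 = 0) ?subr0 //.
    by apply: cfrac_small; rewrite ?subrr ?normr0 //; lra.
  by rewrite /ball /= distrC diff; exact: hd.
move=> p sp; rewrite /L -/(f p).
suff h m : (m <= N)%N ->
    f (0, 0) + \sum_(0 <= k < m) cfrac (f (pt k.+1 p) - f (pt k p)) - f (pt m p) \is a Num.int.
  by have := h N (leqnn _); rewrite ptN.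
elim: m => [_|m IH mN]; first by rewrite big_nil addr0 f00 subrr.
rewrite big_nat_recr //=.
set S := \sum_(0 <= k < m) _; set c := cfrac _.
rewrite (_ : _ - _ = (f (0, 0) + S - f (pt m p)) + (c - (f (pt m.+1 p) - f (pt m p)))); last by ring.
by rewrite rpredD ?IH ?cfrac_int // ltnW.
Qed.

End Simplex.
End Winding.

Section Pairing.
Variables (R : realType) (T : metricType R) (theta : T -> R).
Hypothesis theta_cont : circle_continuous theta.

Lemma winding_ext g h w : {in `[0, 1], g =1 h} -> winding theta g w -> winding theta h w.
Proof.
move=> gh [L [cL Lg ->]]; exists L; split=> // t t01; rewrite -gh; first exact: Lg.
by rewrite in_itv.
Qed.

Lemma winding_cst x : theta x = 0 -> winding theta (fun=> x) 0.
Proof.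
move=> x0; exists (fun=> 0); split; last by rewrite subrr.
- by apply: continuous_subspaceT; exact: cst_continuous.
- by move=> t _; rewrite x0 subrr.
Qed.

Lemma winding_rev g w : winding theta g w -> winding theta (rev_curve g) (- w).
Proof.
case=> L [cL Lg ->]; exists (rev_curve L); split.
- exact: continuous_rev_curve.
- by move=> t t01; apply: Lg; lra.
- by rewrite rev_curve0 rev_curve1 opprB.
Qed.

Lemma winding_cat g h w v : g 1 = h 0 -> winding theta g w -> winding theta h v ->
  winding theta (cat_curve g h) (w + v).
Proof.
move=> gh [L [cL Lg ->]] [K [cK Kh ->]].
pose K' t := K t + (L 1 - K 0).
have K'0 : L 1 = K' 0 by rewrite /K'; ring.
exists (cat_curve L K'); split; last by rewrite cat_curve0 cat_curve1 /K'; ring.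
  apply: continuous_cat_curve K'0 cL _.
  by move=> t; apply: cvgD; [exact: cK|exact: cvg_cst].
move=> t /andP[t0 t1]; rewrite /cat_curve; case: ifPn => [t2|]; first by apply: Lg; lra.
rewrite -ltNge => t2; rewrite /K'.
have -> : K (2 * t - 1) + (L 1 - K 0) - theta (h (2 * t - 1)) =
  (K (2 * t - 1) - theta (h (2 * t - 1))) + ((L 1 - theta (g 1)) - (K 0 - theta (h 0))).
  by rewrite gh; ring.
by apply: rpredD; [|apply: rpredB]; [apply: Kh|apply: Lg|apply: Kh]; lra.
Qed.

Definition winding_number (g : R -> T) : R := xget 0 [set w | winding theta g w].

Lemma winding_numberE g w : winding theta g w -> winding_number g = w.
Proof. by move=> gw; apply: xget_unique => // v /winding_uniq; exact. Qed.

Lemma winding_number_ext g h : {in `[0, 1], g =1 h} -> winding_number g = winding_number h.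
Proof.
move=> gh; congr (xget 0 _); apply/seteqP; split => w /=; apply: winding_ext => //.
by move=> t t01; rewrite gh.
Qed.

Definition chain_winding (c : seq (R * (R -> T))) : R :=
  \sum_(p <- c) p.1 * winding_number p.2.

(** Group the simplices of the chain that agree on [0, 1]: they have the same winding
    number, and their coefficients add up to 0. *)
Lemma chain_winding_eq0 c : (forall tau, chain_coef c tau = 0) -> chain_winding c = 0.
Proof.
have [m] := ubnP (size c); elim: m c => // m IH [|p c]; first by rewrite /chain_winding big_nil.
rewrite /= ltnS => cm coef0.
pose same (q : R * (R -> T)) := `[< {in `[0, 1], q.2 =1 p.2} >].
have pp : same p by apply/asboolP.
rewrite /chain_winding (bigID same) /= [X in X + _](_ : _ = 0); last first.
  transitivity (chain_coef (p :: c) p.2 * winding_number p.2); last by rewrite coef0 mul0r.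
  rewrite /chain_coef mulr_suml; apply: eq_bigr => q /asboolP qp.
  by rewrite (winding_number_ext qp).
rewrite add0r -big_filter; apply: (IH [seq q <- p :: c | ~~ same q]).
  rewrite /= pp /=; apply: leq_ltn_trans cm.
  by rewrite size_filter count_size.
move=> tau; rewrite /chain_coef big_filter_cond /=.
have [tp|tp] := pselect {in `[0, 1], tau =1 p.2}.
  rewrite big1 // => q /andP[/negP nq /asboolP qt]; exfalso; apply: nq.
  by apply/asboolP => t t01; rewrite qt ?tp.
rewrite -[RHS](coef0 tau) /chain_coef; apply: eq_bigl => q.
case: (asboolP {in `[0, 1], q.2 =1 tau}) => qt; rewrite ?andbF // andbT.
apply/negP => /asboolP qp; apply: tp => t t01; by rewrite -qt ?qp.
Qed.

Lemma chain_winding_eq c d : eq_chain1 c d -> chain_winding c = chain_winding d.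
Proof.
move=> cd; pose d' := [seq (- p.1, p.2) | p <- d].
have : chain_winding (c ++ d') = 0.
  apply: chain_winding_eq0 => tau; rewrite /chain_coef big_cat big_map /= sumrN.
  by have := cd tau; rewrite /chain_coef => ->; rewrite subrr.
rewrite /chain_winding big_cat big_map /=.
under [X in _ + X]eq_bigr do rewrite mulNr.
by rewrite sumrN => /subr0_eq.
Qed.

(** The lift over the triangle restricts to a lift along each face, whose winding
    number is therefore the difference of the values at the ends [k] and [j] of the
    face. *)
Lemma winding_face sigma L i (j := nth (0, 0) [:: (1, 0); (0, 0); (0, 0)] i) 
   (k := nth (0, 0) [:: (0, 1); (0, 1); (1, 0)] i) : (i < 3)%N ->
  {within @simplex2 R, continuous L} ->
  (forall p, simplex2 p -> L p - theta (sigma p) \is a Num.int) ->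
  winding_number (face2 sigma i) = L k - L j.
Proof.
move=> i3 cL Ls; apply: winding_numberE.
pose face t := nth (0, 0) [:: (1 - t, t); (0, t); (t, 0)] i : R * R.
have sface t : 0 <= t <= 1 -> simplex2 (face t).
  by rewrite /face; case: i i3 {j k face} => [|[|[|]]] //= _ ?; split => /=; lra.
have fj : face 0 = j by rewrite /face /j; case: i i3 {j k face sface} => [|[|[|]]] //=; rewrite subr0.
have fk : face 1 = k by rewrite /face /k; case: i i3 {j k face sface fj} => [|[|[|]]] //=; rewrite subrr.
exists (L \o face); split; last by rewrite /= fj fk.
- move/within_continuous_ballP: cL => cL; apply/within_continuous_ballP => t.
  rewrite /= in_itv /= => t01 eps eps0; have [dt dt0 h] := cL _ (sface _ t01) _ eps0.
  exists dt => // s; rewrite /= in_itv /= => s01 ts; apply: h; first exact: sface.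
  move: ts; rewrite /face /ball /=; case: i i3 {j k face sface fj fk} => [|[|[|]]] //= _ ts;
    split => //=; rewrite /ball /= ?subrr ?normr0 //.
  by rewrite (_ : _ - _ = s - t) 1?distrC //; ring.
- by move=> t t01; exact/Ls/sface.
Qed.

Lemma null_homologous_winding c : null_homologous c -> chain_winding c = 0.
Proof.
case=> m [d [sigma [csigma /chain_winding_eq ->]]].
rewrite /chain_winding /boundary2 big_allpairs_dep /= big1 // => j _.
have [L cL Ls] := simplex_lift theta_cont (csigma j).
rewrite !big_cons big_nil /= !(winding_face _ cL Ls) //=.
by rewrite expr0 expr1 expr2; ring.
Qed.

End Pairing.

(** * The circle-valued map of an edge, and walks as curves *)

Section GraphCurves.
Variables (R : realType) (T : metricType R) (G : graph_structure T).
Implicit Types (e : gedge G) (v : gvertex G).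

Lemma edge_map_compact e (a b : R) : 0 <= a -> b <= 1 -> compact (edge_map e @` `[a, b]).
Proof.
move=> a0 b1; apply: continuous_compact; last exact: segment_compact.
apply: continuous_subspaceW (@edge_map_continuous _ _ G e) => t.
by rewrite /= !in_itv /=; lra.
Qed.

Lemma edge_map_closed e (a b : R) : 0 <= a -> b <= 1 -> closed (edge_map e @` `[a, b]).
Proof. by move=> a0 b1; apply: compact_closed; [exact: metric_hausdorff|exact: edge_map_compact]. Qed.

Lemma closed_finite_union (I : finType) (F : I -> set T) : (forall i, closed (F i)) ->
  closed [set x | exists i, F i x].
Proof.
move=> Fc; rewrite (_ : [set x | _] = \bigcup_(i in [set: I]) F i).
  by apply: closed_bigcup => //; exact: finite_finset.
by apply/seteqP; split => x [i]; [exists i|move=> _; exists i].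
Qed.

Lemma closed_vertices : closed (range (@vertex_pt _ _ G)).
Proof.
rewrite (_ : range _ = [set x | exists v : gvertex G, [set vertex_pt v] x]).
  apply: closed_finite_union => v; apply: accessible_closed_set1.
  exact/hausdorff_accessible/metric_hausdorff.
by apply/seteqP; split => x [v]; [move=> _ <-; exists v|move=> ->; exists v].
Qed.

(** The map to the circle that runs once around along [e] and sends everything else to
    the base point 0. *)
Definition edge_param e (x : T) : R := xget 0 [set s | 0 < s < 1 /\ x = edge_map e s].

Lemma edge_param_edge e s : 0 < s < 1 -> edge_param e (edge_map e s) = s.
Proof.
move=> s01; apply: xget_unique => // t [t01] /(edge_map_inj s01 t01)[] //.
Qed.

Lemma edge_param_out e x : ~ (exists2 s : R, 0 < s < 1 & x = edge_map e s) -> edge_param e x = 0.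
Proof. by move=> h; apply: xgetPN => s [s01 xs]; apply: h; exists s. Qed.

Lemma edge_param_vertex e x : range (@vertex_pt _ _ G) x -> edge_param e x = 0.
Proof.
by move=> xv; apply: edge_param_out => -[s s01 xs]; apply: (@edge_map_vertex _ _ G e s) => //; rewrite -xs.
Qed.

Lemma edge_param_other e e' s : 0 <= s <= 1 -> e' <> e -> edge_param e (edge_map e' s) = 0.
Proof.
move=> /andP[s0 s1] ee'.
have [->|s0'] := eqVneq s 0; first exact/edge_param_vertex/edge_map_start.
have [->|s1'] := eqVneq s 1; first exact/edge_param_vertex/edge_map_end.
have s01 : 0 < s < 1 by rewrite !lt_neqAle eq_sym s0' s1' s0 s1.
by apply: edge_param_out => -[t t01 /(edge_map_inj s01 t01)[]].
Qed.

(** The set of the points that are sent far from the image of [x] is contained in a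
    finite union of compact sets that does not contain [x]: an inner segment of [e] if
    [x] is sent to 0, and otherwise the vertices, the other edges, and the two segments of
    [e] away from [x]. *)
Lemma edge_param_continuous e : circle_continuous (edge_param e).
Proof.
move=> x eps eps0; pose r := Num.min eps (1 / 4).
have r0 : 0 < r by rewrite lt_min eps0 /=; lra.
have re : r <= eps by rewrite ge_min lexx.
have r4 : r <= 1 / 4 by rewrite ge_min lexx orbT.
have near_closed (Z : set T) : closed Z -> ~ Z x ->
    (forall y, ~ Z y -> `|cfrac (edge_param e y - edge_param e x)| < eps) ->
    \forall y \near x, `|cfrac (edge_param e y - edge_param e x)| < eps.
  move=> Zc Zx h; have : nbhs x (~` Z) by apply: open_nbhs_nbhs; split=> //; exact: closed_openC.
  by apply: filterS => y; exact: h.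
have [[s s01 xs]|xe] := pselect (exists2 s : R, 0 < s < 1 & x = edge_map e s); last first.
  rewrite (edge_param_out xe); rewrite (edge_param_out xe) in near_closed.
  apply: (near_closed (edge_map e @` `[r, 1 - r])).
  - by apply: edge_map_closed; lra.
  - by case=> t; rewrite /= in_itv /= => trr tx; apply: xe; exists t => //; lra.
  move=> y Zy; rewrite subr0.
  have [[t t01 yt]|ye] := pselect (exists2 t : R, 0 < t < 1 & y = edge_map e t); last first.
    rewrite (edge_param_out ye) (@cfrac_small _ _ 0) ?subrr ?normr0 //; lra.
  rewrite yt edge_param_edge //; have [tr|rt] := ltP t r.
    by rewrite (@cfrac_small _ _ t) ?subrr // ger0_norm; lra.
  have t1 : 1 - r < t.
    by rewrite ltNge; apply/negP => tr; apply: Zy; exists t => //; rewrite /= in_itv /= rt.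
  have -> : cfrac t = t - 1.
    apply: cfrac_small; last by rewrite ler0_norm; lra.
    by rewrite addrAC subrr sub0r rpredN rpred1.
  by rewrite ler0_norm; lra.
rewrite xs edge_param_edge //; rewrite xs edge_param_edge // in near_closed.
pose Z := range (@vertex_pt _ _ G) `|` [set y | exists e', [set y | e' <> e /\ (edge_map e' @` `[0, 1]) y] y]
  `|` (edge_map e @` `[0, s - r]) `|` (edge_map e @` `[s + r, 1]).
apply: (near_closed Z).
- apply: closedU; last by apply: edge_map_closed; lra.
  apply: closedU; last by apply: edge_map_closed; lra.
  apply: closedU; first exact: closed_vertices.
  apply: closed_finite_union => e'; have [->|ee'] := pselect (e' = e).
    by rewrite (_ : [set y | _] = set0); [exact: closed0|apply/seteqP; split => y // -[]].
  rewrite (_ : [set y | _] = edge_map e' @` `[0, 1]); first exact: edge_map_closed.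
  by apply/seteqP; split => y; [case|].
- have onedge t : 0 <= t <= 1 -> edge_map e t = edge_map e s -> t = s.
    move=> t01 ts; have [|/negP] := boolP (0 < t < 1).
      by move=> t01'; have [] := edge_map_inj t01' s01 ts.
    move=> nt; exfalso; apply: (@edge_map_vertex _ _ G e s) => //; rewrite -ts.
    have [t0|t0] := ltP 0 t; last by rewrite (_ : t = 0); [exact: edge_map_start|lra].
    by rewrite (_ : t = 1); [exact: edge_map_end|apply/eqP; rewrite eq_le; move: nt; rewrite t0 /= => /negP; rewrite -leNgt; lra].
  case=> [[[|[e' [ee' [t t01 ts]]]]|[t t01 ts]]|[t t01 ts]].
  + exact: edge_map_vertex.
  + have := @edge_param_other e e' t; rewrite ts edge_param_edge // => h.
    move: t01; rewrite /= in_itv /= => /h /(_ ee'); lra.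
  + by move: t01; rewrite /= in_itv /= => t01; have := onedge t _ ts; lra.
  + by move: t01; rewrite /= in_itv /= => t01; have := onedge t _ ts; lra.
move=> y Zy; have [yv|[e' [t [t01 yt]]]] := graph_cover G y.
  by exfalso; apply: Zy; do 3 left.
have ee' : e' = e.
  apply: contrapT => ee'; apply: Zy; left; left; right; exists e'; split => //.
  by exists t => //; rewrite /= in_itv /=; lra.
rewrite {}yt {e'}ee' in Zy *; rewrite edge_param_edge //.
have st : s - r < t.
  rewrite ltNge; apply/negP => ?; apply: Zy; left; right; exists t => //.
  by rewrite /= in_itv /=; lra.
have ts : t < s + r.
  rewrite ltNge; apply/negP => ?; apply: Zy; right; exists t => //.
  by rewrite /= in_itv /=; lra.
have nt : `|t - s| < r by rewrite ltr_norml; lra.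
by rewrite (@cfrac_small _ _ (t - s)) ?subrr //; lra.
Qed.

Lemma winding_edge e e' : winding (edge_param e) (edge_map e') (e' == e)%:R.
Proof.
case: eqP => [->|ee']; last first.
  exists (fun=> 0); split; rewrite ?subrr //.
  - by apply: continuous_subspaceT; exact: cst_continuous.
  - by move=> t t01; rewrite edge_param_other ?subrr.
exists id; split; rewrite ?subr0 //.
- by apply: continuous_subspaceT => t; exact: cvg_id.
move=> t t01; have [->|t0] := eqVneq t 0.
  by rewrite edge_param_vertex ?subrr //; exact: edge_map_start.
have [->|t1] := eqVneq t 1.
  by rewrite edge_param_vertex ?subr0 //; exact: edge_map_end.
rewrite edge_param_edge ?subrr // !lt_neqAle eq_sym t0 t1; lra.
Qed.

Definition gsrc e : gvertex G := projT1 (cid2 (edge_map_start e)).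
Definition gtgt e : gvertex G := projT1 (cid2 (edge_map_end e)).

Lemma gsrcE e : vertex_pt (gsrc e) = edge_map e 0.
Proof. by rewrite /gsrc; case: cid2. Qed.

Lemma gtgtE e : vertex_pt (gtgt e) = edge_map e 1.
Proof. by rewrite /gtgt; case: cid2. Qed.

Definition dart_curve (d : gedge G * bool) : R -> T :=
  if d.2 then edge_map d.1 else rev_curve (edge_map d.1).

Fixpoint walk_curve v (p : seq (gedge G * bool)) : R -> T :=
  if p is d :: q then cat_curve (dart_curve d) (walk_curve (dart_tgt gsrc gtgt d) q)
  else fun=> vertex_pt v.

Lemma is_curve_dart d : is_curve (vertex_pt (dart_src gsrc gtgt d))
  (vertex_pt (dart_tgt gsrc gtgt d)) (dart_curve d).
Proof.
case: d => e b; have ce : is_curve (vertex_pt (gsrc e)) (vertex_pt (gtgt e)) (edge_map e).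
  by split; rewrite ?gsrcE ?gtgtE //; exact: edge_map_continuous.
by case: b; rewrite /dart_curve /dart_src /dart_tgt //=; exact: is_curve_rev.
Qed.

Lemma is_curve_walk U v p w : walk gsrc gtgt U v p w ->
  is_curve (vertex_pt v) (vertex_pt w) (walk_curve v p).
Proof.
elim: p v => [v /andP[/eqP-> _]|d p IH v /= /and3P[_ /eqP<- /IH]]; first exact: is_curve_cst.
exact/is_curve_cat/is_curve_dart.
Qed.

Lemma variation_walk (len : gedge G -> R) U v p w :
  (forall e, variation_le (edge_map e) (len e)) -> walk gsrc gtgt U v p w ->
  variation_le (walk_curve v p) (wlen len p).
Proof.
move=> vlen; elim: p v => [v _|d p IH v /= /and3P[_ _ wp]].
  by rewrite /wlen big_nil; exact: variation_le_cst.
have [_ _ d1] := is_curve_dart d; have [_ p0 _] := is_curve_walk wp.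
rewrite /wlen big_cons; apply: variation_le_cat (IH _ wp); first by rewrite d1 p0.
by rewrite /dart_curve; case: d.2 => //; exact: variation_le_rev.
Qed.

Lemma winding_walk e U v p w : walk gsrc gtgt U v p w ->
  winding (edge_param e) (walk_curve v p) (wcount R p e).
Proof.
elim: p v => [v _|d p IH v /= /and3P[_ _ wp]].
  by rewrite /wcount big_nil; apply: winding_cst; apply: edge_param_vertex; exists v.
have [_ _ d1] := is_curve_dart d; have [_ p0 _] := is_curve_walk wp.
rewrite /wcount big_cons; apply: winding_cat (IH _ wp); first by rewrite d1 p0.
rewrite /dart_curve; have we := winding_edge e d.1.
have -> : (if d.1 == e then if d.2 then 1 else -1 else 0) =
  (if d.2 then (d.1 == e)%:R else - (d.1 == e)%:R) :> R.
  by case: (d.1 == e); case: d.2; rewrite ?oppr0.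
by case: d.2 => //; exact: winding_rev.
Qed.

(** When [P] is a union of components of the graph, its saturation and that of its
    complement are complementary closed sets: this is how connectedness passes from
    the space to the graph. *)
Definition saturation (P : set (gvertex G)) : set T :=
  [set x | exists v, [set x | P v /\ [set vertex_pt v] x] x] `|`
  [set x | exists e, [set x | P (gsrc e) /\ (edge_map e @` `[0, 1]) x] x].

Lemma closed_restr (Q : Prop) (F : set T) : closed F -> closed [set x | Q /\ F x].
Proof.
move=> Fc; have [q|nq] := pselect Q.
  by rewrite (_ : [set x | _] = F) //; apply/seteqP; split => x // -[].
by rewrite (_ : [set x | _] = set0); [exact: closed0|apply/seteqP; split => x // -[]].
Qed.

Lemma closed_saturation P : closed (saturation P).
Proof.
apply: closedU; apply: closed_finite_union => i; apply: closed_restr.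
  by apply: accessible_closed_set1; exact/hausdorff_accessible/metric_hausdorff.
exact: edge_map_closed.
Qed.

Lemma saturation_cover (P : set (gvertex G)) x : saturation P x \/ saturation (~` P) x.
Proof.
have [[v _ <-]|[e [s [s01 ->]]]] := graph_cover G x.
  by have [Pv|Pv] := pselect (P v); [left|right]; left; exists v.
by have [Pe|Pe] := pselect (P (gsrc e)); [left|right]; right; exists e; split => //; exists s => //;
  rewrite /= in_itv /=; lra.
Qed.

Lemma saturation_vertex (P : set (gvertex G)) v : (forall e, P (gsrc e) <-> P (gtgt e)) ->
  saturation P (vertex_pt v) -> P v.
Proof.
move=> Pe [[w [Pw /vertex_pt_inj ->//]]|[e [Pse [s]]]]; rewrite /= in_itv /= => s01 sv.
have [s0|s0] := eqVneq s 0; first by move: sv; rewrite s0 -gsrcE => /vertex_pt_inj <-.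
have [s1|s1] := eqVneq s 1.
  by move: sv; rewrite s1 -gtgtE => /vertex_pt_inj <-; exact/Pe.
exfalso; apply: (@edge_map_vertex _ _ G e s); last by exists v.
by rewrite !lt_neqAle eq_sym s0 s1; lra.
Qed.

Lemma saturation_edge (P : set (gvertex G)) e s : 0 < s < 1 ->
  saturation P (edge_map e s) -> P (gsrc e).
Proof.
move=> s01 [[v [_ sv]]|[e' [Pe' [t]]]].
  by exfalso; apply: (@edge_map_vertex _ _ G e s) => //; rewrite sv; exists v.
rewrite /= in_itv /= => t01 ts; have [t01'|nt] := boolP (0 < t < 1).
  by have [<-] := edge_map_inj t01' s01 ts.
exfalso; apply: (@edge_map_vertex _ _ G e s) => //; rewrite -ts.
have [t0|t0] := eqVneq t 0; first by rewrite t0; exact: edge_map_start.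
have [t1|t1] := eqVneq t 1; first by rewrite t1; exact: edge_map_end.
by move: nt; rewrite !lt_neqAle eq_sym t0 t1 /= t01.
Qed.

Lemma saturation_disjoint P : (forall e, P (gsrc e) <-> P (gtgt e)) ->
  saturation (~` P) = ~` saturation P.
Proof.
move=> Pe; have nPe e : (~` P) (gsrc e) <-> (~` P) (gtgt e).
  by split => /= h /Pe.
apply/seteqP; split => x; last by case: (saturation_cover P x).
move=> nPx Px; have [[v _ vx]|[e [s [s01 xs]]]] := graph_cover G x.
  rewrite -vx in nPx Px.
  exact: (saturation_vertex nPe nPx) (saturation_vertex Pe Px).
by rewrite xs in nPx Px; exact: (saturation_edge s01 nPx) (saturation_edge s01 Px).
Qed.

Lemma graph_connected : connected [set: T] ->
  forall v w : gvertex G, connect (adj gsrc gtgt finset.setT) v w.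
Proof.
move=> conn v w; pose P : set (gvertex G) := [set w | connect (adj gsrc gtgt finset.setT) v w].
have Pe e : P (gsrc e) <-> P (gtgt e).
  have ab : adj gsrc gtgt finset.setT (gsrc e) (gtgt e).
    by apply: (@adj_dart _ _ _ _ _ (e, true)); rewrite finset.in_setT.
  split => /= h; first exact: connect_trans h (connect1 ab).
  by apply: connect_trans h _; apply: connect1; rewrite adj_sym.
have satT : saturation P = [set: T].
  apply: conn.
  - by exists (vertex_pt v); left; exists v; split => //=; exact: connect0.
  - exists (saturation P); last by rewrite setTI.
    by rewrite -[saturation P]setCK -saturation_disjoint //; apply: closed_openC; exact: closed_saturation.
  - by exists (saturation P); [exact: closed_saturation|rewrite setTI].
by apply: (@saturation_vertex P w Pe); rewrite satT.
Qed.

End GraphCurves.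

(** * Hausdorff measure and edge lengths *)

Section Hausdorff.
Variables (R : realType) (T : metricType R).

Lemma compact_separated (A B : set T) : compact A -> closed B -> A `&` B = set0 ->
  \forall dt \near (0 : R)^'+, forall x y, A x -> B y -> dt <= mdist x y.
Proof.
move=> /compact_near_coveringP Ac Bc AB.
have near_A : \forall dt \near (0 : R)^'+, A `<=` (fun x => forall y, B y -> dt <= mdist x y).
  apply: Ac => x Ax; have /nbhs_ballP[r r0 rB] : nbhs x (~` B).
    apply: open_nbhs_nbhs; split; first exact: closed_openC.
    by move=> Bx; have : (A `&` B) x by []; rewrite AB.
  rewrite /= in r0.
  exists (ball x (r / 2), [set e | e < r / 2]); first split => /=.
  - by apply: nbhsx_ballx; rewrite divr_gt0.
  - by apply: nbhs_right_lt; rewrite divr_gt0.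
  move=> [z e] [/= xz er] y By; have : ~ ball x r y by move=> /rB.
  move: xz; rewrite !ballEmdist /= => xz /negP; rewrite -leNgt => ry.
  by have := metric_triangle x z y; lra.
by apply: filterS near_A => dt h x y /h; exact.
Qed.

Lemma diameter_ge0 (A : set T) : (0 <= diameter A)%E.
Proof. by apply: ereal_sup_ubound; left. Qed.

Lemma le_diameter (A : set T) x y : A x -> A y -> ((mdist x y)%:E <= diameter A)%E.
Proof. by move=> Ax Ay; apply: ereal_sup_ubound; right; exists x => //; exists y. Qed.

Section Arcs.
Variables (I : finType) (P : pred I) (g : I -> R -> T) (a b : I -> R).
Hypothesis ab : forall i, a i <= b i.
Hypothesis g_cont : forall i, {within `[a i, b i], continuous (g i)}.
Hypothesis g_disj : forall i j, P i -> P j -> i != j ->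
  (g i @` `[a i, b i]) `&` (g j @` `[a j, b j]) = set0.
Let K i := g i @` `[a i, b i].

Lemma arc_dist_onto i c : 0 <= c <= mdist (g i (a i)) (g i (b i)) ->
  exists2 x, K i x & mdist (g i (a i)) x = c.
Proof.
move=> cd; pose f t := mdist (g i (a i)) (g i t).
have fc : {within `[a i, b i], continuous f}.
  move/within_continuous_ballP: (@g_cont i) => gc; apply/within_continuous_ballP => t ti eps eps0.
  have [dt dt0 h] := gc t ti eps eps0; exists dt => // s si /(h s si).
  rewrite ballEmdist /ball /= /f => ts.
  have := metric_triangle (g i (a i)) (g i t) (g i s).
  have := metric_triangle (g i (a i)) (g i s) (g i t); rewrite (metric_sym (g i s)).
  by rewrite ltr_norml; lra.
have [|t ti ft] := IVT (v := c) (ab i) fc.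
  by rewrite /f mdistxx min_l ?max_r ?mdist_ge0.
by exists (g i t) => //; exists t.
Qed.

(** Each member [U k] of the cover meets at most one arc. The distance to the first end
    of that arc maps [U k] into an interval [J i k] no longer than the diameter of [U k],
    and these intervals cover the segment from 0 to the distance of the ends of the arc. *)
Lemma small_cover_length (dt : R) (U : nat -> set T) :
  (forall i j x y, P i -> P j -> i != j -> K i x -> K j y -> dt < mdist x y) ->
  (forall k, (diameter (U k) <= dt%:E)%E) -> [set: T] `<=` \bigcup_k U k ->
  ((\sum_(i | P i) mdist (g i (a i)) (g i (b i)))%:E <= \sum_(0 <= k <oo) diameter (U k))%E.
Proof.
move=> sep small cover.
pose f i x := mdist (g i (a i)) x.
pose D k := fine (diameter (U k)).
have DE k : (D k)%:E = diameter (U k).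
  rewrite fineK // ge0_fin_numE ?diameter_ge0 //.
  by apply: le_lt_trans (small k) _; rewrite ltry.
have D0 k : 0 <= D k by rewrite -lee_fin DE diameter_ge0.
pose V i k := f i @` (K i `&` U k).
pose J i k := if `[< exists x, K i x /\ U k x >] then `[sup (V i k) - D k, sup (V i k)]%classic
  else set0.
have mJ i k : measurable (J i k) by rewrite /J; case: ifP.
have VJ i k x : K i x -> U k x -> J i k (f i x).
  move=> Kx Ux; rewrite /J asboolT; last by exists x.
  have D_ub y z : K i y -> U k y -> K i z -> U k z -> f i y <= f i z + D k.
    move=> Ky Uy Kz Uz; have : mdist z y <= D k by rewrite -lee_fin DE le_diameter.
    by have := metric_triangle (g i (a i)) z y; rewrite /f; lra.
  have V0 : V i k !=set0 by exists (f i x), x.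
  rewrite /= in_itv /=; apply/andP; split.
    rewrite lerBlDr; apply: ge_sup => // _ [y [Ky Uy] <-]; exact: D_ub.
  apply: sup_upper_bound; last by exists x.
  by split => //; exists (f i x + D k) => _ [y [Ky Uy] <-]; exact: D_ub.
have muJ i k : lebesgue_measure (J i k) = (if `[< exists x, K i x /\ U k x >] then diameter (U k) else 0)%E.
  rewrite /J; case: ifP => _; last by rewrite measure0.
  rewrite lebesgue_measure_itv /= lte_fin -DE ltrBlDr ltrDl.
  case: (ltP 0 (D k)) => h; first by rewrite -EFinD opprB addrC subrK.
  by congr (_%:E); apply/esym/le_anti; rewrite h D0.
have len i : ((mdist (g i (a i)) (g i (b i)))%:E <= \sum_(0 <= k <oo) lebesgue_measure (J i k))%E.
  have <- : lebesgue_measure `[0, mdist (g i (a i)) (g i (b i))]%classic = (mdist (g i (a i)) (g i (b i)))%:E.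
    rewrite lebesgue_measure_itv /= lte_fin; case: ltP => h; first by rewrite -EFinB subr0.
    by congr (_%:E); apply/le_anti; rewrite h mdist_ge0.
  apply: measure_sigma_subadditive => [k||c]; [exact: mJ|exact: measurable_itv|].
  rewrite /= in_itv /= => /arc_dist_onto[x Kx <-].
  have [k _ Uk] : (\bigcup_k U k) x by exact: cover.
  by exists k => //; exact: VJ.
rewrite -sumEFin; apply: le_trans (lee_sum _ (fun i _ => len i)) _.
rewrite -nneseries_sum //; apply: lee_nneseries => [k _ _|k _]; first exact: sume_ge0.
have [i /andP[Pi /asboolP[x [Kx Ux]]]|none] := pickP [pred i | P i && `[< exists x, K i x /\ U k x >]].
  rewrite (bigD1 i) //= muJ asboolT; last by exists x.
  rewrite big1 ?adde0 // => j /andP[Pj ji]; rewrite muJ; case: asboolP => // -[y [Ky Uy]].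
  have := sep _ _ _ _ Pj Pi ji Ky Kx; have := le_trans (le_diameter Uy Ux) (small k).
  by rewrite lee_fin => /le_lt_trans h /h; rewrite ltxx.
rewrite big1 ?diameter_ge0 // => i Pi; rewrite muJ; case: ifP => // hi.
by have := none i; rewrite /= Pi hi.
Qed.

Lemma disjoint_arcs_length (L : R) : hausdorff1 [set: T] = L%:E ->
  \sum_(i | P i) mdist (g i (a i)) (g i (b i)) <= L.
Proof.
move=> HL; rewrite -lee_fin -HL.
have Kc i : compact (K i) by apply: continuous_compact; [exact: g_cont|exact: segment_compact].
have sep : \forall dt \near (0 : R)^'+, forall i j, P i -> P j -> i != j ->
    forall x y, K i x -> K j y -> dt <= mdist x y.
  apply: filter_forall => i; apply: filter_forall => j.
  have [/and3P[Pi Pj ij]|] := boolP [&& P i, P j & i != j]; last first.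
    move=> h; apply: nearW => dt Pi Pj ij; by move: h; rewrite Pi Pj ij.
  apply: filterS (compact_separated (Kc i) (compact_closed (@metric_hausdorff _ T) (Kc j)) (g_disj Pi Pj ij)) => dt h _ _ _; exact: h.
have [dt [/= dt0 hdt]] := filter_ex (filterI (nbhs_right_gt (0 : R)) sep).
apply: (@le_trans _ _ (hausdorff1_delta (dt / 2) [set: T])); last first.
  by apply: ereal_sup_ubound; exists (dt / 2) => //=; rewrite divr_gt0.
apply: le_ereal_inf_tmp => _ [U [small cover] <-].
apply: small_cover_length small cover => i j x y Pi Pj ij Kx Ky.
by have := hdt i j Pi Pj ij x y Kx Ky; lra.
Qed.

End Arcs.
End Hausdorff.

Section EdgeLength.
Variables (R : realType) (T : metricType R) (G : graph_structure T) (L : R).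
Hypothesis HL : hausdorff1 [set: T] = L%:E.

Lemma edge_inner_points (e : gedge G) (u v eps : R) : 0 <= u -> u < v -> v <= 1 -> 0 < eps ->
  exists p : R * R, [/\ u < p.1, p.1 <= p.2, p.2 < v &
    mdist (edge_map e u) (edge_map e v) <= mdist (edge_map e p.1) (edge_map e p.2) + eps].
Proof.
move=> u0 uv v1 eps0; have e2 : 0 < eps / 2 by rewrite divr_gt0.
have /within_continuous_ballP ce := @edge_map_continuous _ _ G e.
have [|d1 d10 h1] := ce u _ _ e2; first by rewrite /= in_itv /=; lra.
have [|d2 d20 h2] := ce v _ _ e2; first by rewrite /= in_itv /=; lra.
pose r := Num.min (Num.min d1 d2) (v - u) / 2.
have r0 : 0 < r by rewrite divr_gt0 // !lt_min d10 d20; lra.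
have [r1 r2 r3] : [/\ 2 * r <= d1, 2 * r <= d2 & 2 * r <= v - u].
  by rewrite /r mulrC divfK // !ge_min !lexx ?orbT.
exists (u + r, v - r); split => /=; try lra.
have := h1 (u + r) _ _; have := h2 (v - r) _ _.
rewrite !ballEmdist /= => /(_ _ _)/wrap[]; first by rewrite in_itv /=; lra.
  by rewrite /ball /= opprB addrC subrK ger0_norm; lra.
move=> m2 /(_ _ _)/wrap[]; first by rewrite in_itv /=; lra.
  by rewrite /ball /= opprD addrA subrr sub0r normrN ger0_norm; lra.
move=> m1; have := metric_triangle (edge_map e u) (edge_map e (u + r)) (edge_map e v).
have := metric_triangle (edge_map e (u + r)) (edge_map e (v - r)) (edge_map e v).
by rewrite (metric_sym (edge_map e (v - r)) (edge_map e v)); lra.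
Qed.

(** The pieces into which subdivisions cut the edges meet at their ends. Shrinking them
    slightly makes them disjoint, at an arbitrarily small loss; constant pieces of the
    subdivisions are left out. *)
Lemma edges_variation (t : gedge G -> nat -> R) (k : nat) :
  (forall e i, 0 <= t e i <= 1) -> (forall e, {homo t e : i j / (i <= j)%N >-> i <= j}) ->
  \sum_e \sum_(i < k) mdist (edge_map e (t e i)) (edge_map e (t e i.+1)) <= L.
Proof.
move=> t01 homo_t; rewrite pair_big /=.
pose I := (gedge G * 'I_k)%type; pose P (i : I) := t i.1 i.2 < t i.1 i.2.+1.
apply/ler_addgt0Pr => eps eps0.
pose eta := eps / (#|{: I}|%:R + 1).
have eta0 : 0 < eta by rewrite divr_gt0 // ltr_wpDl.
have pts i : exists p : R * R, [/\ p.1 <= p.2, 0 <= p.1, p.2 <= 1 &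
    P i -> [/\ t i.1 i.2 < p.1, p.2 < t i.1 i.2.+1 &
    mdist (edge_map i.1 (t i.1 i.2)) (edge_map i.1 (t i.1 i.2.+1)) <=
    mdist (edge_map i.1 p.1) (edge_map i.1 p.2) + eta]].
  have [Pi|] := boolP (P i); last by exists (0, 0).
  have /andP[t0 _] := t01 i.1 i.2; have /andP[_ t1] := t01 i.1 i.2.+1.
  by have [p [p1 p12 p2 hp]] := edge_inner_points i.1 t0 Pi t1 eta0; exists p; split => //; lra.
have [p hp] := choice pts.
have inside i s : P i -> s \in `[(p i).1, (p i).2] -> 0 < s < 1 /\ t i.1 i.2 < s < t i.1 i.2.+1.
  rewrite in_itv /= => Pi sp; have [_ _ _ /(_ Pi)[? ? _]] := hp i.
  by have /andP[? _] := t01 i.1 i.2; have /andP[_ ?] := t01 i.1 i.2.+1; split; lra.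
have arcs : \sum_(i | P i) mdist (edge_map i.1 (p i).1) (edge_map i.1 (p i).2) <= L.
  apply: (@disjoint_arcs_length R T I P (fun i => edge_map i.1) (fun i => (p i).1) (fun i => (p i).2)) => //.
  - by move=> i; have [] := hp i.
  - move=> i; apply: continuous_subspaceW (@edge_map_continuous _ _ G i.1) => s.
    by have [_ ? ? _] := hp i; rewrite /= !in_itv /=; lra.
  move=> [e i] [e' j] Pi Pj ij; apply/seteqP; split => // x [[s sp <-] [s' sp' ss']].
  have [s01 si] := inside _ _ Pi sp; have [s01' sj] := inside _ _ Pj sp'.
  have [ee sse] := edge_map_inj s01' s01 ss'; rewrite /= in ee; subst e' s'.
  rewrite /= in si sj; case/negP: ij; rewrite xpair_eqE eqxx /= -val_eqE /=.
  case: (ltngtP i j) => // lij.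
    by have := homo_t e _ _ lij; lra.
  by have := homo_t e _ _ lij; lra.
apply: (@le_trans _ _ (\sum_(i | P i) (mdist (edge_map i.1 (p i).1) (edge_map i.1 (p i).2) + eta))).
  rewrite [leRHS]big_mkcond /=; apply: ler_sum => i _; case: ifPn => [Pi|].
    by have [_ _ _ /(_ Pi)[]] := hp i.
  rewrite /P -leNgt => tt; rewrite (_ : t i.1 i.2 = t i.1 i.2.+1) ?mdistxx //.
  by apply/le_anti; rewrite tt homo_t.
rewrite big_split /= lerD // sumr_const -mulr_natl /eta mulrCA ger_pMr //.
rewrite ler_pdivrMr ?ltr_wpDl // mul1r.
by apply: le_trans (_ : #|{: I}|%:R <= _); rewrite ?lerDl // ler_nat max_card.
Qed.

Definition edge_length (e : gedge G) : R :=
  sup [set s | exists t k, [/\ forall i, 0 <= t i <= 1, {homo t : i j / (i <= j)%N >-> i <= j} &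
    s = \sum_(i < k) mdist (edge_map e (t i)) (edge_map e (t i.+1))]].

Lemma edge_length_has_sup (e : gedge G) :
  has_sup [set s | exists t k, [/\ forall i, 0 <= t i <= 1, {homo t : i j / (i <= j)%N >-> i <= j} &
    s = \sum_(i < k) mdist (edge_map e (t i)) (edge_map e (t i.+1))]].
Proof.
split.
  by exists 0, (fun=> 0), 0%N; split; rewrite ?big_ord0 // => *; rewrite lexx ler01.
exists L => _ [t [k [t01 homo_t ->]]].
pose u e' := if e' == e then t else (fun=> 0).
have u01 e' i : 0 <= u e' i <= 1 by rewrite /u; case: ifP => // _; rewrite lexx ler01.
have homo_u e' : {homo u e' : i j / (i <= j)%N >-> i <= j}.
  by rewrite /u; case: ifP => // _ i j _; exact: lexx.
apply: le_trans (edges_variation k u01 homo_u).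
rewrite (bigD1 e) //= /u eqxx lerDl; apply: sumr_ge0 => e' _; apply: sumr_ge0 => i _.
exact: mdist_ge0.
Qed.

Lemma variation_edge_length e : variation_le (edge_map e) (edge_length e).
Proof.
move=> t k t01 homo_t; apply: sup_upper_bound; first exact: edge_length_has_sup.
by exists t, k.
Qed.

Lemma edge_length_ge0 e : 0 <= edge_length e.
Proof.
have := @variation_edge_length e (fun=> 0) 0%N; rewrite big_ord0; apply => //.
by move=> i; rewrite lexx ler01.
Qed.

Lemma sum_edge_length : \sum_e edge_length e <= L.
Proof.
apply/ler_addgt0Pr => eps eps0.
pose eta := eps / (#|gedge G|%:R + 1).
have eta0 : 0 < eta by rewrite divr_gt0 // ltr_wpDl.
have pts e : exists tk : (nat -> R) * nat, [/\ forall i, 0 <= tk.1 i <= 1,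
    {homo tk.1 : i j / (i <= j)%N >-> i <= j} &
    edge_length e <= \sum_(i < tk.2) mdist (edge_map e (tk.1 i)) (edge_map e (tk.1 i.+1)) + eta].
  have [_ [t [k [t01 homo_t ->]]] h] := sup_adherent eta0 (edge_length_has_sup e).
  by exists (t, k); split => //=; rewrite -lerBlDr ltW.
have [tk htk] := choice pts.
pose K := (\max_e (tk e).2)%N.
have := @edges_variation (fun e => (tk e).1) K (fun e => let: And3 h _ _ := htk e in h)
  (fun e => let: And3 _ h _ := htk e in h).
move=> hL; apply: (@le_trans _ _ (\sum_e (\sum_(i < K) mdist (edge_map e ((tk e).1 i)) (edge_map e ((tk e).1 i.+1)) + eta))).
  apply: ler_sum => e _; have [_ _ /le_trans] := htk e; apply; rewrite lerD2r.
  have kK : ((tk e).2 <= K)%N by rewrite /K; exact: (leq_bigmax e).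
  rewrite (big_ord_widen K (fun i => mdist (edge_map e ((tk e).1 i)) (edge_map e ((tk e).1 i.+1))) kK).
  by rewrite big_mkcond /=; apply: ler_sum => i _; case: ifP => // _; exact: mdist_ge0.
rewrite big_split /= lerD // sumr_const -mulr_natl /eta mulrCA ger_pMr //.
by rewrite ler_pdivrMr ?ltr_wpDl // mul1r lerDl.
Qed.

End EdgeLength.

Lemma ln2_ge (R : realType) : 1 / 2 <= ln (2 : R).
Proof.
have : expR (1 / 2 : R) <= 2.
  have h := expR_ge1Dx (- (1 / 2) : R).
  rewrite -[1 / 2]opprK expRN -[leRHS]invrK lef_pV2 ?posrE ?expR_gt0 ?invr_gt0 //.
  by apply: le_trans h; lra.
by move=> h; rewrite -[leLHS]expRK ler_ln ?posrE ?expR_gt0.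
Qed.

(** With [k] the least exponent such that [b <= 2 ^ k], the crude bound [ln 2 >= 1/2]
    gives [k <= 1 + 2 ln b], which is good enough for the constant 24. *)
Lemma radius_bound (R : realType) (b n : nat) : (1 < b)%N -> (0 < n)%N ->
  exists2 k, (b <= 2 ^ k)%N &
    2 * ((4 * n + 4 * k)%:R + 1) + 6 * n.-1%:R <= 24 * (ln b%:R + n%:R) :> R.
Proof.
move=> b1 n0; exists (up_log 2 b); first exact: up_logP.
have k0 : (0 < up_log 2 b)%N by rewrite up_log_gt0.
have : (2 ^ (up_log 2 b).-1 <= b)%N by apply: ltnW; exact: up_log_gtn.
rewrite -(prednK k0) /=; set k := (up_log 2 b).-1 => kb.
have : k%:R * (1 / 2) <= ln b%:R :> R.
  apply: (@le_trans _ _ (ln (2 ^ k)%:R)); last first.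
    by rewrite ler_ln ?posrE ?ltr0n ?expn_gt0 ?(ltnW b1) // ler_nat.
  by rewrite natrX lnXn // -[leRHS]mulr_natl ler_wpM2l // ln2_ge.
have n1 : n%:R = n.-1%:R + 1 :> R by rewrite natr1 prednK.
have : 0 <= n.-1%:R :> R by [].
have : 0 <= k%:R :> R by [].
have k1 : k.+1%:R = k%:R + 1 :> R by rewrite natr1.
by rewrite natrD !natrM k1; lra.
Qed.

Lemma num_components_connected (T : topologicalType) (x : T) :
  connected [set: T] -> num_components T = 1%N.
Proof.
move=> conn; rewrite /num_components.
rewrite (_ : [set connected_component [set: T] y | y in [set: T]] = [set [set: T]]).
  by rewrite fset_set1 cardfs1.
have compT y : connected_component [set: T] y = [set: T].
  by apply/seteqP; split => // z _; exists [set: T].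
by apply/seteqP; split => [_ [y _ <-]|_ ->] /=; [exact: compT|exists x].
Qed.

Lemma betti1_euler (R : realType) (T : metricType R) (G : graph_structure T) (b : nat) :
  connected [set: T] -> (0 < b)%N -> betti1 G = b%:Z ->
  exists v0 : gvertex G, (#|gedge G| + 1 = b + #|gvertex G|)%N.
Proof.
move=> conn b0; case: (pickP (@predT (gvertex G))) => [v _|noV].
  rewrite /betti1 (num_components_connected (vertex_pt v)) // => h.
  by exists v; lia.
have noE : #|gedge G| = 0%N.
  by apply: eq_card0 => e; exfalso; have := noV (gsrc e).
rewrite /betti1 /num_components (_ : [set _ | _ in _] = set0); last first.
  apply/seteqP; split => // z [x _ _].
  by case: (graph_cover G x) => [[v _ _]|[e _]]; [have := noV v|have := noV (gsrc e)].
by rewrite fset_set0 cardfs0 noE (eq_card0 noV); lia.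
Qed.

Theorem theorem2 (R : realType) (Gamma : metricType R)
    (G : graph_structure Gamma) (b n : nat)
    (Gamma_connected : connected [set: Gamma])
    (Gamma_length_space : length_space Gamma)
    (b_ge2 : (2 <= b)%N)
    (Gamma_betti : betti1 G = b%:Z)
    (Gamma_length : hausdorff1 [set: Gamma] = (b%:R)%:E)
    (n_range : (1 <= n <= b)%N) :
  exists (x : Gamma) (alpha : 'I_n -> R -> Gamma),
    [/\ forall i, is_loop x (alpha i),
        forall i, (curve_length (alpha i) <= (24 * (ln b%:R + n%:R))%:E)%E
      & homologically_independent alpha].
Proof.
have /andP[n0 nb] := n_range.
have [v0 euler] := betti1_euler Gamma_connected (ltnW b_ge2) Gamma_betti.
have [k bk bound] := radius_bound R b_ge2 n0.
have len_ge0 := edge_length_ge0 (G := G) Gamma_length.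
have [v [w [w_walk w_len w_indep]]] := rich_region_loops len_ge0 (rich_region_exists len_ge0 v0
  (graph_connected Gamma_connected) (sum_edge_length G Gamma_length) euler n_range bk).
exists (vertex_pt v), (fun i => walk_curve v (w i)); split => [i|i|a].
- exact: is_curve_walk (w_walk i).
- apply: le_trans (variation_le_curve_length (variation_walk _ (w_walk i))) _.
    exact: variation_edge_length Gamma_length.
  by rewrite lee_fin; exact: le_trans (w_len i) bound.
move=> null; apply: w_indep => e.
rewrite -[RHS](null_homologous_winding (@edge_param_continuous _ _ _ e) null).
rewrite /chain_winding big_map big_enum /=; apply: eq_bigr => i _.
by rewrite (winding_numberE (winding_walk e (w_walk i))).
Qed.
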